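(* Let $\mu(\Omega)<\infty$ and let $u:\Omega\to\mathbb{C}$ be a measurable function such that the multiplication operator $M_u$, $M_uf=u\cdot f$, belongs to $B(L^\phi_\omega(\Omega))$. Then $M_u$ is a compact operator if and only if $L^\phi_\omega(N(u,\epsilon))$ is finite dimensional for every $\epsilon>0$, where $N(u,\epsilon)=\{x\in\Omega:|u(x)|\ge\epsilon\}$ and $L^\phi_\omega(N(u,\epsilon))=\{f\in L^\phi_\omega(\Omega): f(x)=0\ \ \forall x\notin N(u,\epsilon)\}$.
   Context: $(\Omega,\Sigma,\mu)$ is a $\sigma$-finite complete measure space. $\tau:\Omega\to\Omega$ is a measurable transformation ($\tau^{-1}(A)\in\Sigma$ for all $A\in\Sigma$) which is nonsingular ($\mu(\tau^{-1}(A))=0$ whenever $\mu(A)=0$). The weight $\omega=\frac{d\mu\circ\tau^{-1}}{d\mu}$ is the Radon-Nikodym derivative of $\mu\circ\tau^{-1}$ with respect to $\mu$: a non-negative locally integrable function on $\Omega$ with $\mu(\tau^{-1}(A))=\int_A\omega\,d\mu$ for all $A\in\Sigma$. An Orlicz function is a continuous convex function $\phi:[0,\infty)\to[0,\infty)$ with $\phi(x)=0$ if and only if $x=0$, $\lim_{x\to0}\phi(x)/x=0$ and $\lim_{x\to\infty}\phi(x)/x=\infty$; $\phi$ is such a function. $L^0(\Omega)$ is the linear space of ($\mu$-a.e. equivalence classes of) $\Sigma$-measurable complex-valued functions on $\Omega$. The weighted Orlicz space is $L^\phi_\omega(\Omega)=\{f\in L^0(\Omega):\int_\Omega\phi(\alpha|f|)\,\omega\,d\mu<\infty\text{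 for some }\alpha>0\}$, with norm $\|f\|_{\phi,\omega}=\inf\{k>0:\int_\Omega\phi(|f|/k)\,\omega\,d\mu\le1\}$. $B(L^\phi_\omega(\Omega))$ is the algebra of bounded linear operators on $L^\phi_\omega(\Omega)$.
   Formalization: Functions in the weighted Orlicz space are identified when they agree ω dμ-a.e. rather than μ-a.e.; otherwise the norm is only a seminorm where ω vanishes on a set of positive measure, and the equivalence fails. *)

(* Defs.v *)
From HB Require Import structures.
From mathcomp Require Import all_boot all_order all_algebra complex.
From mathcomp Require Import ring_quotient lra ring.
From mathcomp Require Import all_classical all_reals all_analysis measurable_realfun.

Set Implicit Arguments.
Unset Strict Implicit.
Unset Printing Implicit Defensive.
Import Order.TTheory GRing.Theory Num.Theory numFieldNormedType.Exports.
Import Normc.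

Local Open Scope classical_set_scope.
Local Open Scope ring_scope.
Local Open Scope complex_scope.
Local Open Scope quotient_scope.

(** Only the values of [phi] on [0, +oo[ are constrained, and only those are
    ever used. *)
Record orlicz_function (R : realType) (phi : R -> R) : Prop := OrliczFunction {
  orlicz_ge0 : forall x, 0 <= x -> 0 <= phi x ;
  orlicz_continuous : {within `[0, +oo[, continuous phi} ;
  orlicz_convex : convex_function (`[0, +oo[ : set R^o) phi ;
  orlicz_eq0 : forall x, 0 <= x -> (phi x = 0 <-> x = 0) ;
  orlicz_cvg0 : phi x / x @[x --> 0^'+] --> 0 ;
  orlicz_cvgy : phi x / x @[x --> +oo] --> +oo }.

Definition nonsingular d (T : measurableType d) (R : realType)
    (mu : {measure set T -> \bar R}) (tau : T -> T) :=
  forall A, measurable A -> mu A = 0%E -> mu (tau @^-1` A) = 0%E.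

(** [omega] is the Radon-Nikodym derivative of [mu \o tau^-1] with respect to
    [mu]. In a measure space without topology, locally integrable means
    integrable over every measurable set of finite measure. *)
Record is_RN_weight d (T : measurableType d) (R : realType)
    (mu : {measure set T -> \bar R}) (tau : T -> T) (omega : T -> R) : Prop :=
  IsRNWeight {
    RN_weight_locally_integrable : forall A, measurable A ->
      (mu A < +oo)%E -> mu.-integrable A (EFin \o omega) ;
    RN_weight_integral : forall A, measurable A ->
      mu (tau @^-1` A) = (\int[mu]_(x in A) (omega x)%:E)%E }.

Definition measurable_complex d (T : measurableType d) (R : realType)
    (f : T -> R[i]) :=
  measurable_fun setT (fun x => complex.Re (f x)) /\
  measurable_fun setT (fun x => complex.Im (f x)).

Section modular.
Context d (T : measurableType d) (R : realType).
Variables (mu : {measure set T -> \bar R}) (phi : R -> R) (omega : T -> R).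

Definition modular (a : R) (f : T -> R[i]) : \bar R :=
  (\int[mu]_x (phi (a * normc (f x)) * omega x)%:E)%E.

Definition luxemburg_norm (f : T -> R[i]) : R :=
  inf [set k : R | 0 < k /\ (modular k^-1 f <= 1)%E].

Definition orlicz_class : {pred T -> R[i]} := fun f =>
  `[< measurable_complex f /\
      exists2 a : R, 0 < a & (modular a f < +oo)%E >].

End modular.

Section orlicz_function_theory.
Context (R : realType) (phi : R -> R).
Hypothesis phiO : orlicz_function phi.

Lemma orlicz0 : phi 0 = 0.
Proof. by apply/(orlicz_eq0 phiO). Qed.

Lemma orlicz_conv (t x y : R) : 0 <= t <= 1 -> 0 <= x -> 0 <= y ->
  phi (t * x + (1 - t) * y) <= t * phi x + (1 - t) * phi y.
Proof.
move=> /andP[t0 t1] x0 y0.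
have := @orlicz_convex _ _ phiO (Itv01 t0 t1) x y.
by rewrite !inE /= !in_itv /= !andbT; apply.
Qed.

Lemma orlicz_scale (t x : R) : 0 <= t <= 1 -> 0 <= x -> phi (t * x) <= t * phi x.
Proof.
move=> t01 x0; have := orlicz_conv t01 x0 (lexx 0).
by rewrite mulr0 orlicz0 mulr0 !addr0.
Qed.

Lemma orlicz_homo (x y : R) : 0 <= x -> x <= y -> phi x <= phi y.
Proof.
move=> x0 xy; have y0 : 0 <= y by apply: le_trans xy.
have [y00|yn0] := eqVneq y 0.
  by have -> : x = y by apply/eqP; rewrite eq_le xy y00 x0.
have yp : 0 < y by rewrite lt_neqAle eq_sym yn0.
have t01 : 0 <= x / y <= 1 by rewrite divr_ge0//= ler_pdivrMr// mul1r.
have := orlicz_scale t01 y0; rewrite divfK// => /le_trans; apply.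
by rewrite ler_piMl ?(orlicz_ge0 phiO)//; case/andP: t01.
Qed.

Lemma orlicz_measurable d (T : measurableType d) (g : T -> R) :
  measurable_fun setT g -> (forall x, 0 <= g x) ->
  measurable_fun setT (phi \o g).
Proof.
move=> mg g0.
have -> : phi \o g = (fun x => phi (Num.max 0 x)) \o g.
  by apply/funext => x /=; rewrite max_r.
apply: measurableT_comp => //; apply: nondecreasing_measurable => // x y xy.
apply: orlicz_homo; first by rewrite le_max lexx.
by rewrite ge_max !le_max lexx xy orbT.
Qed.

End orlicz_function_theory.

Lemma normc_ge0 (R : realType) (z : R[i]) : 0 <= normc z.
Proof. by case: z => a b /=; exact: sqrtr_ge0. Qed.

Lemma measurable_normc d (T : measurableType d) (R : realType) (f : T -> R[i]) :
  measurable_complex f -> measurable_fun setT (fun x => normc (f x)).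
Proof.
move=> [mr mi].
have -> : (fun x => normc (f x)) =
    Num.sqrt \o (fun x => complex.Re (f x) ^+ 2 + complex.Im (f x) ^+ 2).
  by apply/funext => x /=; case: (f x).
apply: measurableT_comp.
  by apply: nondecreasing_measurable => // x y; exact: ler_wsqrtr.
by apply: measurable_funD; apply: measurable_funX.
Qed.

Section measurable_complex_theory.
Context d (T : measurableType d) (R : realType).
Implicit Types f g : T -> R[i].

Lemma measurable_complex0 : measurable_complex (0 : T -> R[i]).
Proof. by split; exact: measurable_cst. Qed.

Lemma measurable_complexD f g : measurable_complex f -> measurable_complex g ->
  measurable_complex (f + g).
Proof.
move=> [fr fi] [gr gi]; split.
- rewrite (_ : (fun _ => _) = (fun x => complex.Re (f x)) \+ (fun x => complex.Re (g x))).
    exact: measurable_funD.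
  by apply/funext => x; rewrite [in LHS]/GRing.add /=; case: (f x); case: (g x).
- rewrite (_ : (fun _ => _) = (fun x => complex.Im (f x)) \+ (fun x => complex.Im (g x))).
    exact: measurable_funD.
  by apply/funext => x; rewrite [in LHS]/GRing.add /=; case: (f x); case: (g x).
Qed.

Lemma measurable_complexM f g : measurable_complex f -> measurable_complex g ->
  measurable_complex (fun x => f x * g x).
Proof.
move=> [fr fi] [gr gi]; split.
- rewrite (_ : (fun _ => _) = ((fun x => complex.Re (f x)) \* (fun x => complex.Re (g x))) \-
     ((fun x => complex.Im (f x)) \* (fun x => complex.Im (g x)))).
    by apply: measurable_funB; exact: measurable_funM.
  by apply/funext => x /=; case: (f x) => a b; case: (g x).
- rewrite (_ : (fun _ => _) = ((fun x => complex.Re (f x)) \* (fun x => complex.Im (g x))) \+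
     ((fun x => complex.Im (f x)) \* (fun x => complex.Re (g x)))).
    by apply: measurable_funD; exact: measurable_funM.
  by apply/funext => x /=; case: (f x) => a b; case: (g x).
Qed.

Lemma measurable_complexZ (c : R[i]) f : measurable_complex f ->
  measurable_complex (c *: f).
Proof.
move=> mf; have -> : c *: f = (fun x => cst c x * f x) by [].
by apply: measurable_complexM => //; split; exact: measurable_cst.
Qed.

End measurable_complex_theory.

Section modular_theory.
Context d (T : measurableType d) (R : realType).
Variables (mu : {measure set T -> \bar R}) (phi : R -> R).
Variable omega : {mfun T >-> R}.
Hypothesis phiO : orlicz_function phi.
Hypothesis omega_ge0 : forall x, 0 <= omega x.
Local Notation modular := (modular mu phi omega).
Local Notation norm := (luxemburg_norm mu phi omega).
Local Notation Lphi := (orlicz_class mu phi omega).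
Implicit Types f g : T -> R[i].

Lemma modular_integrand_ge0 a f x :
  0 <= a -> 0 <= phi (a * normc (f x)) * omega x.
Proof.
move=> a0; rewrite mulr_ge0//; apply: (orlicz_ge0 phiO).
by rewrite mulr_ge0// normc_ge0.
Qed.

Lemma measurable_modular_integrand a f : 0 <= a -> measurable_complex f ->
  measurable_fun setT (fun x => phi (a * normc (f x)) * omega x).
Proof.
move=> a0 mf; apply: measurable_funM => //.
apply: (@orlicz_measurable _ _ phiO _ _ (fun x => a * normc (f x))).
  by apply: measurable_funM => //; exact: measurable_normc.
by move=> x; rewrite mulr_ge0// normc_ge0.
Qed.

Lemma modular_ge0 a f : 0 <= a -> (0 <= modular a f)%E.
Proof.
by move=> a0; apply: integral_ge0 => x _; rewrite lee_fin modular_integrand_ge0.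
Qed.

Lemma modular_conv (s t a b c : R) f g h : measurable_complex f ->
    measurable_complex g -> measurable_complex h ->
    0 <= s -> 0 <= t -> 0 <= a -> 0 <= b -> 0 <= c ->
    (forall x, phi (c * normc (h x)) <=
      s * phi (a * normc (f x)) + t * phi (b * normc (g x))) ->
  (modular c h <= s%:E * modular a f + t%:E * modular b g)%E.
Proof.
move=> mf mg mh s0 t0 a0 b0 c0 H.
rewrite -!ge0_integralZl ?lee_fin//; last 4 first.
- by apply/measurable_EFinP; exact: measurable_modular_integrand.
- by move=> x _; rewrite lee_fin modular_integrand_ge0.
- by apply/measurable_EFinP; exact: measurable_modular_integrand.
- by move=> x _; rewrite lee_fin modular_integrand_ge0.
rewrite -ge0_integralD//; last 4 first.
- by move=> x _; rewrite -EFinM lee_fin mulr_ge0// modular_integrand_ge0.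
- apply/measurable_EFinP; apply: measurable_funM => //.
  exact: measurable_modular_integrand.
- by move=> x _; rewrite -EFinM lee_fin mulr_ge0// modular_integrand_ge0.
- apply/measurable_EFinP; apply: measurable_funM => //.
  exact: measurable_modular_integrand.
apply: ge0_le_integral => //.
- by move=> x _; rewrite lee_fin modular_integrand_ge0.
- by apply/measurable_EFinP; exact: measurable_modular_integrand.
- apply/measurable_EFinP; apply: measurable_funD; apply: measurable_funM => //;
  exact: measurable_modular_integrand.
move=> x _; rewrite -!EFinM -EFinD lee_fin !mulrA -mulrDl.
by rewrite ler_wpM2r.
Qed.

Lemma modular_scale (t a : R) f : measurable_complex f ->
  0 <= t <= 1 -> 0 <= a -> (modular (t * a) f <= t%:E * modular a f)%E.
Proof.
move=> mf t01 a0; have /andP[t0 t1] := t01.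
have := @modular_conv t 0 a 0 (t * a) f f f mf mf mf t0 (lexx 0) a0 (lexx 0)
  (mulr_ge0 t0 a0).
rewrite mul0e adde0; apply=> x; rewrite !mul0r addr0 -mulrA.
by rewrite (orlicz_scale phiO)// mulr_ge0// normc_ge0.
Qed.

Lemma normcD (z w : R[i]) : normc (z + w) <= normc z + normc w.
Proof. exact: le_normcD. Qed.

Lemma modularD (k l : R) f g : measurable_complex f -> measurable_complex g ->
  0 < k -> 0 < l ->
  (modular (k + l)^-1 (f + g)%R <= (k / (k + l))%:E * modular k^-1 f
                               + (l / (k + l))%:E * modular l^-1 g)%E.
Proof.
move=> mf mg k0 l0; have kl0 : 0 < k + l by rewrite addr_gt0.
apply: modular_conv => //; rewrite ?divr_ge0 ?invr_ge0 ?(ltW k0) ?(ltW l0)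
  ?(ltW kl0)//.
  exact: measurable_complexD.
move=> x; have E : l / (k + l) = 1 - k / (k + l).
  by field; rewrite gt_eqF.
have t01 : 0 <= k / (k + l) <= 1.
  by rewrite divr_ge0 ?(ltW k0) ?(ltW kl0)//= ler_pdivrMr// mul1r lerDl ltW.
rewrite E; apply: le_trans (orlicz_conv phiO t01 _ _); last 2 first.
- by rewrite mulr_ge0 ?invr_ge0 ?(ltW k0)// normc_ge0.
- by rewrite mulr_ge0 ?invr_ge0 ?(ltW l0)// normc_ge0.
apply: (orlicz_homo phiO).
  by rewrite mulr_ge0 ?invr_ge0 ?(ltW kl0)// normc_ge0.
have -> : k / (k + l) * (k^-1 * normc (f x)) +
    (1 - k / (k + l)) * (l^-1 * normc (g x)) =
    (k + l)^-1 * (normc (f x) + normc (g x)).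
  by field; rewrite !gt_eqF.
by rewrite ler_wpM2l ?invr_ge0 ?(ltW kl0)// normcD.
Qed.

Lemma orlicz_classP f : reflect (measurable_complex f /\
    exists2 a : R, 0 < a & (modular a f < +oo)%E) (f \in Lphi).
Proof. exact: asboolP. Qed.

Lemma modular0 a : modular a 0 = 0%E.
Proof.
rewrite /modular; under eq_integral => x _ do
  rewrite normc0 mulr0 (orlicz0 phiO) mul0r.
exact: integral0.
Qed.

Lemma modularZ (c : R[i]) a f : modular a (c *: f) = modular (a * normc c) f.
Proof.
by rewrite /modular; apply: eq_integral => x _; rewrite /= normcM mulrA.
Qed.

Lemma orlicz_class_submod : submod_closed Lphi.
Proof.
split.
  apply/orlicz_classP; split; first exact: measurable_complex0.
  by exists 1 => //; rewrite modular0 ltry.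
move=> c f g /orlicz_classP[mf [a a0 fa]] /orlicz_classP[mg [b b0 gb]].
have mcf := measurable_complexZ c mf.
apply/orlicz_classP; split; first exact: measurable_complexD.
have [a' a'0 fa'] : exists2 a', 0 < a' & (modular a' (c *: f) < +oo)%E.
  have [c0|c0] := eqVneq (normc c) 0.
    exists 1 => //; have -> : c = 0 by exact: eq0_normc.
    by rewrite scale0r modular0 ltry.
  by exists (a / normc c); rewrite ?modularZ ?divfK// divr_gt0//
    lt_neqAle eq_sym c0 normc_ge0.
exists ((a'^-1 + b^-1)^-1); first by rewrite invr_gt0 addr_gt0 ?invr_gt0.
apply: le_lt_trans.
  by apply: (@modularD a'^-1 b^-1); rewrite ?invr_gt0.
rewrite !invrK; set s := (_ / _); set t := (_ / _).
by apply: lte_add_pinfty; apply: lte_mul_pinfty => //;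
  rewrite ?lee_fin /s /t ?divr_ge0 ?addr_ge0 ?invr_ge0 ?(ltW a'0) ?(ltW b0).
Qed.

Let S f := [set k : R | 0 < k /\ (modular k^-1 f <= 1)%E].

Lemma luxemburg_nonempty f : f \in Lphi -> S f !=set0.
Proof.
move=> /orlicz_classP[mf [a a0 fa]].
have fin : modular a f \is a fin_num by rewrite ge0_fin_numE// modular_ge0// ltW.
pose m := Num.max 1 (fine (modular a f)).
have m1 : 1 <= m by rewrite le_max lexx.
have m0 : 0 < m by apply: lt_le_trans m1.
exists (m / a); split; first by rewrite divr_gt0.
rewrite invf_div mulrC; apply: le_trans (modular_scale mf _ (ltW a0)) _.
  by rewrite invr_ge0 ltW//= invf_le1.
rewrite -(fineK fin) -EFinM lee_fin mulrC ler_pdivrMr// mul1r.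
by rewrite le_max lexx orbT.
Qed.

Lemma luxemburg_lb f : lbound (S f) 0.
Proof. by move=> k [/ltW]. Qed.

Lemma luxemburg_ge0 f : 0 <= norm f.
Proof.
case: (eqVneq (S f) set0) => [S0|/set0P S0].
  by rewrite /luxemburg_norm -/(S f) S0 inf0.
exact: lb_le_inf S0 (@luxemburg_lb f).
Qed.

Lemma luxemburg_le f k : 0 < k -> (modular k^-1 f <= 1)%E -> norm f <= k.
Proof. by move=> k0 kf; apply: ge_inf => //; exists 0; exact: luxemburg_lb. Qed.

Lemma luxemburg_lt f k : f \in Lphi -> norm f < k -> (modular k^-1 f <= 1)%E.
Proof.
move=> fL fk; have [mf _] := elimT (orlicz_classP _) fL.
have [l [l0 lf] lk] : exists2 l, S f l & l < k.
  by apply: inf_lt => //; exact: luxemburg_nonempty.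
have k0 : 0 < k by apply: lt_trans lk.
have -> : k^-1 = (l / k) * l^-1 by rewrite mulrAC divff ?mul1r// gt_eqF.
apply: le_trans (modular_scale mf _ _) _; rewrite ?invr_ge0 ?(ltW l0)//.
  by rewrite divr_ge0 ?(ltW l0) ?(ltW k0)//= ler_pdivrMr// mul1r ltW.
have lk0 : (0 <= (l / k)%:E)%E by rewrite lee_fin divr_ge0 ?(ltW l0) ?(ltW k0).
apply: le_trans (lee_wpmul2l lk0 lf) _.
by rewrite mule1 lee_fin ler_pdivrMr// mul1r ltW.
Qed.

Lemma luxemburgD f g : f \in Lphi -> g \in Lphi ->
  norm (f + g) <= norm f + norm g.
Proof.
move=> fL gL; apply/ler_addgt0Pr => e e0.
have [mf _] := elimT (orlicz_classP _) fL.
have [mg _] := elimT (orlicz_classP _) gL.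
pose k := norm f + e / 2; pose l := norm g + e / 2.
have k0 : 0 < k by rewrite ltr_wpDl ?luxemburg_ge0// divr_gt0.
have l0 : 0 < l by rewrite ltr_wpDl ?luxemburg_ge0// divr_gt0.
have kl0 : 0 < k + l by rewrite addr_gt0.
have -> : norm f + norm g + e = k + l by rewrite /k /l; field.
apply: luxemburg_le => //; apply: le_trans (modularD mf mg k0 l0) _.
have fk : (modular k^-1 f <= 1)%E.
  by apply: luxemburg_lt => //; rewrite ltrDl divr_gt0.
have gl : (modular l^-1 g <= 1)%E.
  by apply: luxemburg_lt => //; rewrite ltrDl divr_gt0.
have := leeD (lee_wpmul2l (x := (k / (k + l))%:E) _ fk)
             (lee_wpmul2l (x := (l / (k + l))%:E) _ gl).
rewrite !lee_fin !mule1 -EFinD -mulrDl divff ?gt_eqF//; apply.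
  by rewrite divr_ge0 ?(ltW k0) ?(ltW kl0).
by rewrite divr_ge0 ?(ltW l0) ?(ltW kl0).
Qed.

Lemma luxemburg0 : norm 0 = 0.
Proof.
apply/eqP; rewrite eq_le luxemburg_ge0 andbT; apply/ler_addgt0Pr => e e0.
by rewrite add0r; apply: luxemburg_le => //; rewrite modular0 lee_fin.
Qed.

Lemma luxemburgZ_le (c : R[i]) f : f \in Lphi -> norm (c *: f) <= normc c * norm f.
Proof.
move=> fL; have [/eq0_normc ->|c0] := eqVneq (normc c) 0.
  by rewrite scale0r luxemburg0 normc0 mul0r.
have cp : 0 < normc c by rewrite lt_neqAle eq_sym c0 normc_ge0.
rewrite -ler_pdivrMl// mulrC; apply/ler_addgt0Pr => e e0.
have k0 : 0 < norm f + e by rewrite ltr_wpDl ?luxemburg_ge0.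
rewrite ler_pdivrMr//; apply: luxemburg_le; first by rewrite mulr_gt0.
rewrite modularZ invfM divfK//.
by apply: luxemburg_lt => //; rewrite ltrDl.
Qed.

Lemma luxemburgZ (c : R[i]) f : f \in Lphi -> norm (c *: f) = normc c * norm f.
Proof.
move=> fL; apply/eqP; rewrite eq_le luxemburgZ_le//=.
have [/eq0_normc ->|c0] := eqVneq (normc c) 0.
  by rewrite scale0r luxemburg0 normc0 mul0r.
have cp : 0 < normc c by rewrite lt_neqAle eq_sym c0 normc_ge0.
have cn0 : c != 0 by apply: contraNneq c0 => ->; rewrite normc0.
have cfL : c *: f \in Lphi.
  by have := (orlicz_class_submod).2 c f 0 fL (orlicz_class_submod).1; rewrite addr0.
have := luxemburgZ_le c^-1 cfL.
by rewrite scalerA mulVf// scale1r normcV ler_pdivlMl.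
Qed.

(** Almost everywhere for the measure [omega dmu]. *)
Definition weighted_null f : Prop :=
  f = (fun=> 0) %[ae mu in [set x | omega x != 0]].

Lemma modular_eq0 a f : measurable_complex f -> weighted_null f -> 0 <= a ->
  modular a f = 0%E.
Proof.
move=> mf fN a0; rewrite /modular.
rewrite (@ge0_ae_eq_integral _ _ _ mu setT _ (cst 0%E)) ?integral0//.
- by apply/measurable_EFinP; exact: measurable_modular_integrand.
- by move=> x _; rewrite lee_fin modular_integrand_ge0.
apply: filterS fN => x /= fx _.
have [->|/fx ->] := eqVneq (omega x) 0; first by rewrite mulr0.
by rewrite normc0 mulr0 (orlicz0 phiO) mul0r.
Qed.

Lemma luxemburg_null f : f \in Lphi -> norm f = 0 <-> weighted_null f.
Proof.
move=> fL; have [mf _] := elimT (orlicz_classP _) fL; split=> [f0|fN]; last first.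
  apply/eqP; rewrite eq_le luxemburg_ge0 andbT; apply/ler_addgt0Pr => e e0.
  by rewrite add0r luxemburg_le// modular_eq0 ?invr_ge0 ?(ltW e0) ?lee_fin.
have M0 : modular 1 f = 0%E.
  apply/eqP; rewrite eq_le modular_ge0// andbT; apply/lee_addgt0Pr => e e0.
  rewrite add0e; pose k := Num.min e 1.
  have k0 : 0 < k by rewrite lt_min e0 ltr01.
  have k1 : 0 <= k <= 1 by rewrite (ltW k0) ge_min lexx orbT.
  have kf : (modular k^-1 f <= 1)%E by apply: luxemburg_lt => //; rewrite f0.
  rewrite -(@divff _ k) ?gt_eqF//.
  apply: le_trans (modular_scale mf k1 _) _; first by rewrite invr_ge0 ltW.
  have k0' : (0 <= k%:E)%E by rewrite lee_fin ltW.
  apply: le_trans (lee_wpmul2l k0' kf) _.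
  by rewrite mule1 lee_fin ge_min lexx.
have : ae_eq mu setT (fun x => (phi (1 * normc (f x)) * omega x)%:E) (cst 0%E).
  apply/ae_eq_integral_abs => //.
    by apply/measurable_EFinP; exact: measurable_modular_integrand.
  rewrite -[RHS]M0; apply: eq_integral => x _.
  by rewrite gee0_abs// lee_fin modular_integrand_ge0.
apply: filterS => x /(_ I) /= [/eqP]; rewrite mulf_eq0 => /orP[|/eqP ->]; last first.
  by rewrite eqxx.
move=> /eqP; rewrite mul1r => /(orlicz_eq0 phiO _).1 fx _.
by apply: eq0_normc; apply: fx; exact: normc_ge0.
Qed.

End modular_theory.

(** The weighted Orlicz space of [phi] with weight [omega]: measurable complex
    functions in the class, identified when they agree [omega dmu]-almost
    everywhere, that is, up to functions of norm zero. When [omega] is positive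
    almost everywhere this is the [mu]-almost everywhere identification. *)
Section orlicz_space.
Context d (T : measurableType d) (R : realType).
Variables (mu : {measure set T -> \bar R}) (phi : R -> R).
Hypothesis phiO : orlicz_function phi.
Variable omega : {mfun T >-> R}.
Hypothesis omega_ge0 : forall x, 0 <= omega x.

(** The two proofs are parameters of the type, so that its module structure can
    be inferred. *)
Definition Lphi (_ : orlicz_function phi) (_ : forall x, 0 <= omega x) :
  {pred T -> R[i]} := orlicz_class mu phi omega.

HB.instance Definition _ := GRing.isSubmodClosed.Build R[i] (T -> R[i])
  (Lphi phiO omega_ge0) (orlicz_class_submod mu phiO omega_ge0).

Record orlicz_fun := OrliczFun {
  orlicz_fun_val :> T -> R[i] ;
  orlicz_funP : orlicz_fun_val \in Lphi phiO omega_ge0 }.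

HB.instance Definition _ := [isSub for orlicz_fun_val].
HB.instance Definition _ := [Choice of orlicz_fun by <:].
HB.instance Definition _ := [SubChoice_isSubLmodule of orlicz_fun by <:].

Definition orlicz_null : {pred orlicz_fun} :=
  fun f => `[< weighted_null mu omega f >].

Lemma orlicz_nullP (f : orlicz_fun) :
  reflect (luxemburg_norm mu phi omega f = 0) (f \in orlicz_null).
Proof.
by apply: (iffP (asboolP _)) => /(luxemburg_null phiO omega_ge0 (orlicz_funP f)).
Qed.

Lemma orlicz_null_submod : submod_closed orlicz_null.
Proof.
split; first by apply/asboolP; apply: aeW.
move=> c f g /asboolP f0 /asboolP g0; apply/asboolP.
apply: filterS2 f0 g0 => x /= fx gx wx.
rewrite -[LHS]/(c * f x + g x).
by rewrite fx// gx// mulr0 addr0.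
Qed.

HB.instance Definition _ := GRing.isSubmodClosed.Build R[i] orlicz_fun
  orlicz_null orlicz_null_submod.

Definition orlicz_space : Type := @Quotient.quot orlicz_fun orlicz_null.
HB.instance Definition _ := GRing.Zmodule.on orlicz_space.
HB.instance Definition _ := EqQuotient.on orlicz_space.

Lemma orlicz_spaceP (f g : orlicz_fun) :
  f = g %[mod orlicz_space] <->
  (orlicz_fun_val f = orlicz_fun_val g %[ae mu in [set x | omega x != 0]]).
Proof.
split=> [/eqP|fg].
  rewrite -Quotient.idealrBE => /asboolP; apply: filterS => x /= fg wx.
  by apply/eqP; rewrite -subr_eq0; apply/eqP; exact: fg.
apply/eqP; rewrite -Quotient.idealrBE; apply/asboolP; apply: filterS fg.
move=> x /= fg wx; rewrite -[LHS]/(f x - g x); apply/eqP; rewrite subr_eq0.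
by apply/eqP; exact: fg.
Qed.

Lemma orlicz_spaceB (f g : orlicz_fun) :
  f = g %[mod orlicz_space] <-> f - g \in orlicz_null.
Proof. by rewrite Quotient.idealrBE; split => /eqP. Qed.

Lemma orlicz_pi_reprB (f : orlicz_fun) :
  repr (\pi_orlicz_space f) - f \in orlicz_null.
Proof. by apply/orlicz_spaceB; rewrite reprK. Qed.

Definition orlicz_scaler (a : R[i]) (x : orlicz_space) : orlicz_space :=
  \pi_orlicz_space (a *: repr x).

Lemma pi_orliczD (f g : orlicz_fun) :
  \pi_orlicz_space (f + g) = \pi_orlicz_space f + \pi_orlicz_space g.
Proof. by rewrite !piE. Qed.

Lemma pi_orlicz_scale a (f : orlicz_fun) :
  orlicz_scaler a (\pi_orlicz_space f) = \pi_orlicz_space (a *: f).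
Proof.
by apply/orlicz_spaceB; rewrite -scalerBr rpredZ// orlicz_pi_reprB.
Qed.

Let scaleA a b (x : orlicz_space) :
  orlicz_scaler a (orlicz_scaler b x) = orlicz_scaler (a * b) x.
Proof.
elim/quotW: x => f.
by rewrite (pi_orlicz_scale b f) (pi_orlicz_scale a (b *: f))
  (pi_orlicz_scale (a * b) f) scalerA.
Qed.

Let scale1 : left_id 1 orlicz_scaler.
Proof. by elim/quotW => f; rewrite (pi_orlicz_scale 1 f) scale1r. Qed.

Let scaleDr : right_distributive orlicz_scaler +%R.
Proof.
move=> a; elim/quotW => f; elim/quotW => g.
by rewrite -pi_orliczD (pi_orlicz_scale a (f + g)) (pi_orlicz_scale a f)
  (pi_orlicz_scale a g) scalerDr pi_orliczD.
Qed.

Let scaleDl (x : orlicz_space) : {morph orlicz_scaler^~ x : a b / a + b}.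
Proof.
move=> a b; elim/quotW: x => f.
by rewrite (pi_orlicz_scale (a + b) f) (pi_orlicz_scale a f)
  (pi_orlicz_scale b f) scalerDl pi_orliczD.
Qed.

HB.instance Definition _ := GRing.Zmodule_isLmodule.Build R[i] orlicz_space
  scaleA scale1 scaleDr scaleDl.

Lemma pi_orliczZ a (f : orlicz_fun) :
  \pi_orlicz_space (a *: f) = a *: \pi_orlicz_space f.
Proof. by rewrite -pi_orlicz_scale. Qed.

(** The scalars being complex, the norm has to take its values in [R[i]]. *)
Definition orlicz_norm (x : orlicz_space) : R[i] :=
  (luxemburg_norm mu phi omega (repr x))%:C.

Lemma orlicz_normE (f : orlicz_fun) :
  orlicz_norm (\pi_orlicz_space f) = (luxemburg_norm mu phi omega f)%:C.
Proof.
congr (_%:C).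
have le (g h : orlicz_fun) : g - h \in orlicz_null ->
    luxemburg_norm mu phi omega g <= luxemburg_norm mu phi omega h.
  move=> /orlicz_nullP gh; rewrite -[g in leLHS](subrK h).
  have := luxemburgD phiO omega_ge0 (orlicz_funP (g - h)) (orlicz_funP h).
  by rewrite gh add0r.
have fr := orlicz_pi_reprB f.
by apply/eqP; rewrite eq_le !le// -opprB rpredN.
Qed.

Let norm_le (x y : orlicz_space) :
  orlicz_norm (x + y) <= orlicz_norm x + orlicz_norm y.
Proof.
rewrite -[x]reprK -[y]reprK -pi_orliczD !orlicz_normE -rmorphD lecR.
exact: (luxemburgD phiO omega_ge0 (orlicz_funP _) (orlicz_funP _)).
Qed.

Let normZ (a : R[i]) (x : orlicz_space) :
  orlicz_norm (a *: x) = `|a| * orlicz_norm x.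
Proof.
rewrite -[x]reprK -pi_orliczZ !orlicz_normE.
rewrite (luxemburgZ phiO omega_ge0 a (orlicz_funP (repr x))) rmorphM.
by congr (_ * _); case: a.
Qed.

Let norm_eq0 (x : orlicz_space) : orlicz_norm x = 0 -> x = 0.
Proof.
rewrite -[x]reprK orlicz_normE => -[x0].
have -> : 0 = \pi_orlicz_space 0 by rewrite piE.
by apply/orlicz_spaceB; rewrite subr0; exact/orlicz_nullP.
Qed.

HB.instance Definition _ := Lmodule_isNormed.Build R[i] orlicz_space
  norm_le normZ norm_eq0.

(** The classes having a representative that vanishes at every point outside
    [A]. *)
Definition orlicz_supported (A : set T) : set orlicz_space :=
  [set \pi_orlicz_space f | f in [set f : orlicz_fun | forall x, ~ A x -> f x = 0]].

(** [M] is the operator of multiplication by [u]; in particular [u * f] belongs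
    to the class for every [f] in it. *)
Definition is_multiplication (u : T -> R[i]) (M : orlicz_space -> orlicz_space) :=
  forall f : orlicz_fun, exists2 g : orlicz_fun,
    (forall x, g x = u x * f x) & M (\pi_orlicz_space f) = \pi_orlicz_space g.

End orlicz_space.

Arguments orlicz_supported {d T R} mu {phi} phiO {omega} omega_ge0 A.

Section operators.
Context (K : numFieldType) (V : normedModType K).

Definition bounded_operator (M : V -> V) :=
  linear M /\ exists C : K, forall x, `|M x| <= C * `|x|.

Definition compact_operator (M : V -> V) :=
  compact (closure (M @` [set x | `|x| <= 1])).

Definition finite_dimensional (S : set V) :=
  exists n (b : 'I_n -> V), (forall i, S (b i)) /\
    forall x, S x -> exists c : 'I_n -> K, x = \sum_i c i *: b i.

End operators.

(* Main.v *)
(** Write [N(eps)] for the set where [|u| >= eps]. A measurable set that is not,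
    up to the null sets of [omega dmu], a finite union of atoms contains
    infinitely many disjoint non-null sets [B n], and the space of functions
    supported on it is then infinite dimensional; on an atom every measurable
    function is a.e. constant, so a finite union of atoms carries a finite
    dimensional space. If [M_u] is compact and [B n] lie in [N(eps)], the images
    of the normalised indicators of the [B n] are [eps]-separated, which is
    impossible. Conversely, if every [N(eps)] is a finite union of atoms, then
    [u != 0] is a countable one, and the unit ball, restricted to it, is
    parametrised by the values on the atoms. Those values range over a closed
    (Fatou) subset of a product of segments, compact by Tychonoff; as [|u| <= 1/N]
    off finitely many atoms, [M_u f] depends continuously on them, so the image of
    the ball is compact. *)
Require Import Defs.
From HB Require Import structures.
From mathcomp Require Import all_boot all_order all_algebra complex.
From mathcomp Require Import all_classical all_reals all_analysis.
From mathcomp Require Import ring_quotient ring measurable_realfun.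
Import Order.TTheory GRing.Theory Num.Theory numFieldNormedType.Exports.
Import Normc.
Local Open Scope classical_set_scope.
Local Open Scope ring_scope.
Local Open Scope complex_scope.

Set Implicit Arguments.
Unset Strict Implicit.
Unset Printing Implicit Defensive.

(** * Null sets, atoms and finite unions of atoms for the measure [omega dmu] *)

Section weighted_almost_everywhere.
Context d (T : measurableType d) (R : realType).
Variables (mu : {measure set T -> \bar R}) (omega : {mfun T >-> R}).

(** The conull sets of [omega dmu], as a filter so that the [near] notations apply. It is improper
    when [omega] vanishes a.e., hence a [Filter] instance and not a [ProperFilter] one. *)
Definition weighted_ae : set_system T :=
  within [set x | omega x != 0] (almost_everywhere mu).

Global Instance weighted_ae_filter : Filter weighted_ae.
Proof. exact: within_filter. Qed.

Lemma weighted_ae_foralln (P : nat -> T -> Prop) :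
  (forall n, \forall x \near weighted_ae, P n x) ->
  \forall x \near weighted_ae, forall n, P n x.
Proof.
move=> H; have := ae_foralln H; apply: filterS => x Px wx n; exact: Px.
Qed.

Definition weighted_negligible (E : set T) := \forall x \near weighted_ae, ~ E x.

Lemma weighted_negligibleS E F : F `<=` E ->
  weighted_negligible E -> weighted_negligible F.
Proof. by rewrite /weighted_negligible => FE; apply: filterS => x nE /FE. Qed.

(** An atom of [omega dmu] or a null set; admitting null sets avoids a case distinction in
    decompositions. *)
Definition indivisible (E : set T) := forall B, measurable B ->
  weighted_negligible (E `&` B) \/ weighted_negligible (E `\` B).

(** The constant is the essential supremum of [g] on [E]. *)
Lemma indivisible_ae_cst_real E (g : T -> R) :
  indivisible E -> measurable_fun setT g ->
  exists c, \forall x \near weighted_ae, E x -> g x = c.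
Proof.
move=> indE mg.
have [E0|E0] := pselect (weighted_negligible E).
  by exists 0; move: E0; rewrite /weighted_negligible; apply: filterS => x nE /nE.
pose S := [set t : R | weighted_negligible (E `&` [set x | t < g x])].
(* Cutting [E] at the level [t] leaves a null set on one side. *)
have dich t : S t \/ weighted_negligible (E `&` [set x | g x <= t]).
  have mB : measurable [set x | t < g x].
    have -> : [set x | t < g x] = setT `&` g @^-1` `]t, +oo[.
      by apply/seteqP; split => x /=; rewrite in_itv/= andbT => // -[].
    exact: mg.
  have [|H] := indE _ mB; [by left|right].
  by apply: weighted_negligibleS H => x [Ex /= xt]; split => //=; apply/negP; rewrite -leNgt.
have Sup s t : S s -> s <= t -> S t.
  move=> + st; apply: weighted_negligibleS => x [Ex /= tx]; split => //=.
  exact: le_lt_trans tx.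
(* If countably many sets cover the space, they cannot all meet the non-null [E] in null sets. This
   makes [S] neither empty nor all of [R], so that [inf S] is a genuine infimum. *)
have absurd (P : R -> set T) : (forall x, exists n : nat, P n%:R x) ->
    ~ (forall t, weighted_negligible (E `&` P t)).
  move=> Px nP; apply: E0; have := weighted_ae_foralln (fun n => nP n%:R).
  by apply: filterS => x nPx Ex; have [n Pn] := Px x; apply: (nPx n).
have [s Ss] : exists s, S s.
  apply: contrapT => /forallNP nS.
  apply: (absurd (fun t => [set x | g x <= t])) => [x|t]; last by have [/nS|] := dich t.
  exists (Num.truncn `|g x|).+1 => /=;
  by apply/ltW; apply: le_lt_trans (ler_norm _) _; exact: truncnS_gt.
have [t0 St0] : exists t, ~ S t.
  apply: contrapT => /forallNP nS.
  apply: (absurd (fun t => [set x | - t < g x])) => [x|t].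
    exists (Num.truncn `|g x|).+1 => /=; rewrite ltrNl.
    apply: le_lt_trans (ler_norm _) _; rewrite normrN; exact: truncnS_gt.
  exact: contrapT (nS (- t)).
have lbS : lbound S t0.
  move=> r Sr; rewrite leNgt; apply/negP => rt; apply: St0; exact: Sup (ltW rt).
exists (inf S).
have H1 n : S (inf S + n.+1%:R^-1).
  have [r Sr rlt] : exists2 r, S r & r < inf S + n.+1%:R^-1.
    by apply: inf_lt; [exists s|rewrite ltrDl].
  exact: Sup (ltW rlt).
have H2 n : weighted_negligible (E `&` [set x | g x <= inf S - n.+1%:R^-1]).
  have [Sn|//] := dich (inf S - n.+1%:R^-1).
  have := ge_inf (ex_intro _ t0 lbS) Sn.
  by rewrite lerBrDr gerDl leNgt invr_gt0 ltr0n.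
have := weighted_ae_foralln H1; have := weighted_ae_foralln H2.
apply: filterS2 => x h2 h1 Ex; apply/eqP; rewrite eq_le !leNgt; apply/andP; split.
  apply/negP => /ltr_add_invr[k]; exact: (fun h => h1 k (conj Ex h)).
apply/negP => /ltr_add_invr[k hk]; apply: (h2 k); split => //=.
by rewrite lerBrDr ltW.
Qed.

Definition ae_constant (E : set T) := measurable E /\
  forall f : T -> R[i], measurable_complex f ->
    exists c, \forall x \near weighted_ae, E x -> f x = c.

Lemma indivisible_ae_constant E :
  measurable E -> indivisible E -> ae_constant E.
Proof.
move=> mE indE; split=> // f [mr mi].
have [a Ha] := indivisible_ae_cst_real indE mr.
have [b Hb] := indivisible_ae_cst_real indE mi.
exists (Complex a b); apply: filterS2 Ha Hb => x ha hb Ex.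
by rewrite -(ha Ex) -(hb Ex); case: (f x).
Qed.

(** A finite union of atoms, encoded by a labelling of the points: the pieces are then disjoint
    automatically, and pieces may be empty or null. *)
Definition ae_simple (A : set T) := exists m (i : T -> nat),
  (forall x, (i x < m)%N) /\ forall k, ae_constant (A `&` [set x | i x = k]).

Lemma ae_constant_set0 : ae_constant set0.
Proof. by split=> // f _; exists 0; apply: filterE. Qed.

Lemma ae_constant_simple E : ae_constant E -> ae_simple E.
Proof.
move=> cE; exists 1%N, (fun=> 0%N); split=> // -[|k].
  by rewrite (_ : [set _ | _] = setT) ?setIT//; apply/seteqP; split.
rewrite (_ : [set _ | _] = set0) ?setI0; first exact: ae_constant_set0.
by apply/seteqP; split.
Qed.

Lemma ae_simpleU B C : measurable B -> B `&` C = set0 ->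
  ae_simple B -> ae_simple C -> ae_simple (B `|` C).
Proof.
move=> mB BC [m [i [im ci]]] [n [j [jn cj]]].
(* The labels on [C] are shifted by [m] to keep them apart from those on [B]. *)
exists (m + n)%N, (fun x => if `[< B x >] then i x else m + j x)%N; split.
  move=> x; case: asboolP => _; first exact: ltn_addr.
  by rewrite ltn_add2l.
have CnB x : C x -> B x -> False by move=> Cx Bx; rewrite -[False]/(set0 x) -BC.
move=> k; case: (ltnP k m) => km.
  rewrite (_ : _ `&` _ = B `&` [set x | i x = k])//; apply/seteqP; split=> x /=.
    by case: asboolP => [? []|_ [_ E]] //; move: km; rewrite -E ltnNge leq_addr.
  by case: asboolP => [? []|nB []] //; split => //; left.
rewrite (_ : _ `&` _ = C `&` [set x | j x = (k - m)%N])//; apply/seteqP; split=> x /=.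
  case: asboolP => [Bx [_ E]|nBx [[//|Cx] <-]]; last by rewrite addKn.
  by move: km; rewrite -E leqNgt im.
by move=> [Cx E]; case: asboolP => [/(CnB _ Cx)//|_]; split; [right|rewrite E subnKC].
Qed.

(** Not being indivisible, [A] is cut into two non-null halves. They are not both finite unions of
    atoms, or [A] would be one; a bad half becomes [A'], ready to be split again, and the other one
    becomes [B]. *)
Lemma ae_simple_split A : measurable A -> ~ ae_simple A ->
  exists B A', [/\ measurable B, B `<=` A & ~ weighted_negligible B] /\
    [/\ measurable A', A' `<=` A, ~ ae_simple A' & B `&` A' = set0].
Proof.
move=> mA nA.
have [B [mB nB1 nB2]] : exists B, [/\ measurable B,
    ~ weighted_negligible (A `&` B) & ~ weighted_negligible (A `\` B)].
  apply: contrapT => /forallNP H; apply: nA; apply: ae_constant_simple.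
  apply: indivisible_ae_constant => // B mB; apply: contrapT => /not_orP[? ?].
  exact: (H B).
have mAB : measurable (A `&` B) by exact: measurableI.
have mADB : measurable (A `\` B) by exact: measurableD.
have dis : (A `&` B) `&` (A `\` B) = set0.
  by apply/seteqP; split=> x // [[_ ?] []].
have [H1|H1] := pselect (ae_simple (A `&` B)); last first.
  exists (A `\` B), (A `&` B); split; split => //.
  by rewrite setIC.
exists (A `&` B), (A `\` B); split; split => //.
move=> H2; apply: nA; have := ae_simpleU mAB dis H1 H2.
by rewrite setUIDK.
Qed.

(** The splitting is iterated on the bad remainder: [B n] is disjoint from the remainder left at its
    step, which contains all later [B]s. *)
Lemma not_ae_simple_sequence A : measurable A -> ~ ae_simple A ->
  exists B : nat -> set T,
    (forall n, [/\ measurable (B n), B n `<=` A & ~ weighted_negligible (B n)]) /\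
    forall m n, (m < n)%N -> B m `&` B n = set0.
Proof.
move=> mA nA; pose bad A' := measurable A' /\ ~ ae_simple A'.
(* The sigma type carries the invariant, so that [choice] yields a step function that can be
   iterated. *)
have step (A1 : {A' | bad A'}) : exists BA : set T * {A' | bad A'},
    [/\ measurable BA.1, BA.1 `<=` projT1 A1 & ~ weighted_negligible BA.1] /\
    (projT1 BA.2 `<=` projT1 A1 /\ BA.1 `&` projT1 BA.2 = set0).
  case: A1 => A1 [mA1 nA1] /=.
  have [B [A' [? [mA' ? nA' ?]]]] := ae_simple_split mA1 nA1.
  by exists (B, exist _ A' (conj mA' nA')).
have [F HF] := choice step.
pose S n := iter n (fun A1 => (F A1).2) (exist _ A (conj mA nA)).
have Sle m n : (m <= n)%N -> projT1 (S n) `<=` projT1 (S m).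
  move=> /subnK <-; elim: (n - m)%N => [//|k IH]; rewrite addSn.
  by apply: subset_trans IH; have [_ []] := HF (S (k + m)%N).
exists (fun n => (F (S n)).1); split=> [n|m n mn].
  have [[? h ?] _] := HF (S n); split => //.
  exact: subset_trans h (Sle 0%N n (leq0n n)).
have [_ [_ E]] := HF (S m); have [[_ h _] _] := HF (S n).
apply/seteqP; split => // x [xm xn]; rewrite -E; split => //.
exact: (Sle m.+1 n mn) (h _ xn).
Qed.

End weighted_almost_everywhere.

(** * Domination, a.e. equality and the Fatou property for the Luxemburg norm *)

Section orlicz_norm_comparison.
Context d (T : measurableType d) (R : realType).
Variables (mu : {measure set T -> \bar R}) (phi : R -> R).
Hypothesis phiO : orlicz_function phi.
Variable omega : {mfun T >-> R}.
Hypothesis omega_ge0 : forall x, 0 <= omega x.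
Local Notation modular := (modular mu phi omega).
Local Notation norm := (luxemburg_norm mu phi omega).
Local Notation Lphi := (orlicz_class mu phi omega).
Implicit Types f g h : T -> R[i].

Lemma normcR (r : R) : normc r%:C = `|r|.
Proof. by rewrite /normc/= expr0n addr0 sqrtr_sqr. Qed.

Lemma normc_indic (A : set T) x : normc (\1_A x : R)%:C = \1_A x.
Proof. by rewrite normcR ger0_norm. Qed.

Lemma measurable_complexR (g : T -> R) : measurable_fun setT g ->
  measurable_complex (fun x => (g x)%:C).
Proof. by move=> mg; split => //; exact: measurable_cst. Qed.

Lemma measurable_complex_cst (c : R[i]) : measurable_complex (fun _ : T => c).
Proof. by split; exact: measurable_cst. Qed.

Lemma modular_le a f g : 0 <= a -> measurable_complex f -> measurable_complex g ->
  (forall x, normc (f x) <= normc (g x)) -> (modular a f <= modular a g)%E.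
Proof.
move=> a0 mf mg fg; apply: ge0_le_integral => //.
- by move=> x _; rewrite lee_fin (modular_integrand_ge0 phiO omega_ge0).
- by apply/measurable_EFinP; exact: measurable_modular_integrand.
- by apply/measurable_EFinP; exact: measurable_modular_integrand.
move=> x _; rewrite lee_fin ler_wpM2r//.
by apply: (orlicz_homo phiO); [rewrite mulr_ge0// normc_ge0|rewrite ler_wpM2l].
Qed.

Lemma orlicz_class_measurable f : f \in Lphi -> measurable_complex f.
Proof. by case/orlicz_classP. Qed.

Lemma luxemburg_dominated f g : measurable_complex f -> g \in Lphi ->
  (forall x, normc (f x) <= normc (g x)) -> f \in Lphi /\ norm f <= norm g.
Proof.
move=> mf gL fg; have [mg [a a0 ga]] := elimT (orlicz_classP _ _ _ _) gL; split.
  apply/orlicz_classP; split => //; exists a => //.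
  by apply: le_lt_trans ga; exact: modular_le (ltW a0) _ _ _.
apply/ler_addgt0Pr => e e0.
have k0 : 0 < norm g + e by rewrite ltr_wpDl// luxemburg_ge0.
apply: luxemburg_le => //.
apply: le_trans (_ : (modular (norm g + e)^-1 g <= 1)%E).
  by apply: modular_le => //; rewrite invr_ge0 ltW.
by apply: luxemburg_lt => //; rewrite ltrDl.
Qed.

(** Passing to moduli, which does not increase the norm, turns the bound into domination by the
    single function [abs g + abs h]; the triangle inequality then applies. *)
Lemma luxemburg_dominatedD f g h : measurable_complex f ->
  g \in Lphi -> h \in Lphi ->
  (forall x, normc (f x) <= normc (g x) + normc (h x)) ->
  f \in Lphi /\ norm f <= norm g + norm h.
Proof.
move=> mf gL hL fgh.
pose abs (k : T -> R[i]) (x : T) : R[i] := (normc (k x))%:C.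
have absL k : k \in Lphi -> abs k \in Lphi /\ norm (abs k) <= norm k.
  move=> kL; apply: luxemburg_dominated => //.
    apply: measurable_complexR; apply: measurable_normc.
    exact: orlicz_class_measurable.
  by move=> x; rewrite normcR ger0_norm// normc_ge0.
have [agL ag] := absL _ gL; have [ahL ah] := absL _ hL.
have sL : abs g + abs h \in Lphi.
  have := (orlicz_class_submod mu phiO omega_ge0).2 1 _ _ agL ahL.
  by rewrite scale1r.
have [|fL fle] := luxemburg_dominated mf sL.
  move=> x; have -> : (abs g + abs h) x = (normc (g x) + normc (h x))%:C.
    by rewrite rmorphD.
  by rewrite normcR ger0_norm ?addr_ge0 ?normc_ge0.
split=> //; apply: le_trans fle _.
by apply: le_trans (luxemburgD phiO omega_ge0 agL ahL) _; exact: lerD.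
Qed.

Lemma weighted_null_class f : measurable_complex f -> weighted_null mu omega f ->
  f \in Lphi /\ norm f = 0.
Proof.
move=> mf f0.
have fL : f \in Lphi.
  by apply/orlicz_classP; split => //; exists 1 => //; rewrite modular_eq0 ?ltry.
by split => //; apply/(luxemburg_null phiO omega_ge0 fL).
Qed.

(** The difference [g - f] is null, hence of norm 0, and [|g| <= |f| + |g - f|]. *)
Lemma luxemburg_ae_eq f g : f \in Lphi -> measurable_complex g ->
  (\forall x \near weighted_ae mu omega, g x = f x) ->
  g \in Lphi /\ norm g <= norm f.
Proof.
move=> fL mg gf; have mf := orlicz_class_measurable fL.
have [||kL k0] := @weighted_null_class (g - f) _ _.
- have -> : g - f = g + (-1) *: f by rewrite scaleN1r.
  by apply: measurable_complexD => //; exact: measurable_complexZ.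
- by apply: filterS gf => x gfx; rewrite -[LHS]/(g x - f x) gfx// subrr.
rewrite -[norm f]addr0 -k0; apply: luxemburg_dominatedD => // x.
apply: le_trans (normcD _ _); rewrite -[X in _ <= X]/(normc (f x + (g x - f x))).
by rewrite addrC subrK.
Qed.

(** The modular at 1 is at most [phi C] times the total mass of [omega dmu], which is finite. *)
Lemma bounded_orlicz_class f C : mu.-integrable setT (EFin \o omega) ->
  measurable_complex f -> (forall x, normc (f x) <= C) -> f \in Lphi.
Proof.
move=> iom mf fC; apply/orlicz_classP; split => //; exists 1 => //.
have i2 : mu.-integrable setT (fun x => (phi C)%:E * (EFin \o omega) x)%E.
  exact: integrableZl.
apply: le_lt_trans (integrable_lty measurableT i2).
apply: ge0_le_integral => //.
- by move=> x _; rewrite lee_fin (modular_integrand_ge0 phiO omega_ge0).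
- by apply/measurable_EFinP; exact: measurable_modular_integrand.
- exact: measurable_int i2.
move=> x _; rewrite /= -EFinM lee_fin ler_wpM2r// mul1r.
by apply: (orlicz_homo phiO); rewrite ?normc_ge0.
Qed.

Lemma indic_orlicz_class A : mu.-integrable setT (EFin \o omega) ->
  measurable A -> (fun x => (\1_A x)%:C) \in Lphi.
Proof.
move=> iom mA; apply: (@bounded_orlicz_class _ 1) => //.
  by apply: measurable_complexR; exact: measurable_indic.
by move=> x; rewrite normc_indic indicE lern1 leq_b1.
Qed.

Lemma measurable_complex_indic A f : measurable A -> measurable_complex f ->
  measurable_complex (fun x => (\1_A x)%:C * f x).
Proof.
move=> mA mf; apply: measurable_complexM => //.
by apply: measurable_complexR; exact: measurable_indic.
Qed.

(** For each [k > 1] the truncations have modular at most 1 at [k^-1], and monotone convergence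
    passes this to [f]; then [k] decreases to 1. The strict inequality is what [luxemburg_lt]
    requires. *)
Lemma luxemburg_fatou f (W : nat -> set T) : measurable_complex f ->
  (forall n, measurable (W n)) -> {homo W : m n / (m <= n)%N >-> m `<=` n} ->
  (forall x, f x != 0 -> exists n, W n x) ->
  (forall n, (fun x => (\1_(W n) x)%:C * f x) \in Lphi /\
             norm (fun x => (\1_(W n) x)%:C * f x) <= 1) ->
  f \in Lphi /\ norm f <= 1.
Proof.
move=> mf mW ndW fW H.
have key k : 1 < k -> (modular k^-1 f <= 1)%E.
  move=> k1; have k0 : 0 < k by exact: lt_trans k1.
  have ik0 : 0 <= k^-1 by rewrite invr_ge0 ltW.
  pose g n x := (phi (k^-1 * normc ((\1_(W n) x)%:C * f x)) * omega x)%:E.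
  have mg n : measurable_fun setT (g n).
    apply/measurable_EFinP; apply: measurable_modular_integrand => //.
    exact: measurable_complex_indic.
  have g0 n x : setT x -> (0 <= g n x)%E.
    by move=> _; rewrite lee_fin mulr_ge0// (orlicz_ge0 phiO)// mulr_ge0 ?normc_ge0.
  have ndg x : setT x -> {homo g^~ x : m n / (m <= n)%N >-> (m <= n)%E}.
    move=> _ m n mn; rewrite /g lee_fin ler_wpM2r//; apply: (orlicz_homo phiO).
      by rewrite mulr_ge0 ?normc_ge0.
    rewrite ler_wpM2l// !normcM !normc_indic ler_wpM2r ?normc_ge0//.
    by rewrite !indicE ler_nat; case: (boolP (x \in W m)) => // /set_mem/(ndW _ _ mn)/mem_set ->.
  have -> : modular k^-1 f = (\int[mu]_x limn (g^~ x))%E.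
    apply: eq_integral => x _; apply/esym/cvg_lim => //.
    have [fx0|/fW [N WN]] := eqVneq (f x) 0.
      by rewrite /g fx0; under eq_fun do rewrite mulr0; exact: cvg_cst.
    apply: cvg_near_cst; exists N => // n /= Nn; rewrite /g indicE mem_set ?mul1r//.
    exact: ndW Nn _ WN.
  rewrite monotone_convergence//; apply: lime_le.
    by apply: ereal_nondecreasing_is_cvgn => m n mn; apply: ge0_le_integral => // x _; [exact: g0|exact: ndg].
  apply: nearW => n; have [fnL fn1] := H n.
  by have := luxemburg_lt phiO omega_ge0 fnL (le_lt_trans fn1 k1).
split.
  apply/orlicz_classP; split => //; exists 2^-1; first by rewrite invr_gt0.
  by apply: le_lt_trans (key 2 _) (ltry _); rewrite ltr1n.
apply/ler_addgt0Pr => e e0; apply: luxemburg_le; first by rewrite addr_gt0.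
by apply: key; rewrite ltrDl.
Qed.

End orlicz_norm_comparison.

(** * Transfer between functions and their classes in the quotient space *)

Section orlicz_classes.
Context d (T : measurableType d) (R : realType).
Variables (mu : {measure set T -> \bar R}) (phi : R -> R).
Variable phiO : orlicz_function phi.
Variable omega : {mfun T >-> R}.
Variable omega_ge0 : forall x, 0 <= omega x.
Local Notation norm := (luxemburg_norm mu phi omega).
Local Notation Lphi := (orlicz_class mu phi omega).
Local Notation V := (orlicz_space mu phiO omega_ge0).
Implicit Types (f g : T -> R[i]) (A : set T).

(** Junk value: functions outside the class are sent to [0]. *)
Definition cls f : V :=
  \pi_V%qT (insubd (0 : orlicz_fun mu phiO omega_ge0) f).

Lemma orlicz_classD f g : f \in Lphi -> g \in Lphi -> f + g \in Lphi.
Proof.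
move=> fL gL; have := (orlicz_class_submod mu phiO omega_ge0).2 1 _ _ fL gL.
by rewrite scale1r.
Qed.

Lemma orlicz_classZ c f : f \in Lphi -> c *: f \in Lphi.
Proof.
have [L0 Llin] := orlicz_class_submod mu phiO omega_ge0.
by move=> fL; have := Llin c _ _ fL L0; rewrite addr0.
Qed.

Lemma orlicz_classB f g : f \in Lphi -> g \in Lphi -> f - g \in Lphi.
Proof. by move=> fL gL; rewrite -scaleN1r orlicz_classD// orlicz_classZ. Qed.

Lemma val_insubd_class f : f \in Lphi ->
  insubd (0 : orlicz_fun mu phiO omega_ge0) f = f :> (T -> R[i]).
Proof. by move=> fL; exact: (insubdK _ fL). Qed.

Lemma cls_pi (f : orlicz_fun mu phiO omega_ge0) : cls f = \pi_V%qT f.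
Proof. by rewrite /cls; congr (\pi_V%qT _); exact: valKd. Qed.

Lemma cls_surj (x : V) : exists2 f, f \in Lphi & x = cls f.
Proof.
by exists (repr x); [exact: orlicz_funP|rewrite cls_pi reprK].
Qed.

Lemma norm_cls f : f \in Lphi -> `|cls f| = (norm f)%:C.
Proof. by move=> fL; rewrite -[LHS]/(orlicz_norm _) orlicz_normE val_insubd_class. Qed.

Lemma clsD f g : f \in Lphi -> g \in Lphi -> cls (f + g) = cls f + cls g.
Proof.
move=> fL gL; rewrite /cls -pi_orliczD; congr (\pi_V%qT _); apply: val_inj.
by rewrite /= !val_insubd_class// orlicz_classD.
Qed.

Lemma clsZ c f : f \in Lphi -> cls (c *: f) = c *: cls f.
Proof.
move=> fL; rewrite /cls -pi_orliczZ; congr (\pi_V%qT _); apply: val_inj.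
by rewrite /= !val_insubd_class// orlicz_classZ.
Qed.

Lemma clsB f g : f \in Lphi -> g \in Lphi -> cls (f - g) = cls f - cls g.
Proof.
by move=> fL gL; rewrite -scaleN1r clsD ?orlicz_classZ// clsZ// scaleN1r.
Qed.

Lemma orlicz_class0 : (0 : T -> R[i]) \in Lphi.
Proof. exact: (orlicz_class_submod mu phiO omega_ge0).1. Qed.

Lemma cls0 : cls 0 = 0.
Proof. by rewrite -[in LHS](scale0r (0 : T -> R[i])) clsZ ?scale0r// orlicz_class0. Qed.

Lemma cls_sum n (c : 'I_n -> R[i]) (f : 'I_n -> T -> R[i]) :
  (forall i, f i \in Lphi) ->
  \sum_i c i *: f i \in Lphi /\ cls (\sum_i c i *: f i) = \sum_i c i *: cls (f i).
Proof.
move=> fL; elim/big_ind2: _ => [|f1 x1 f2 x2 [L1 <-] [L2 <-]|i _].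
- by split; [exact: orlicz_class0|exact: cls0].
- by split; [exact: orlicz_classD|exact: clsD].
- by split; [exact: orlicz_classZ|exact: clsZ].
Qed.

Lemma cls_eqP f g : f \in Lphi -> g \in Lphi ->
  cls f = cls g <-> \forall x \near weighted_ae mu omega, f x = g x.
Proof.
move=> fL gL; have := @orlicz_spaceP _ _ _ mu _ phiO _ omega_ge0
  (insubd 0 f) (insubd 0 g).
by rewrite !val_insubd_class.
Qed.

Lemma orlicz_supportedP A (x : V) : orlicz_supported mu phiO omega_ge0 A x <->
  exists f, [/\ f \in Lphi, forall t, ~ A t -> f t = 0 & x = cls f].
Proof.
split=> [[f fA <-]|[f [fL fA ->]]].
  by exists f; split => //; [exact: orlicz_funP|rewrite cls_pi].
by exists (insubd 0 f) => //= t; rewrite val_insubd_class//; exact: fA.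
Qed.

Section multiplication.
Variables (u : T -> R[i]) (M : V -> V).
Hypothesis M_mul : is_multiplication u M.

Lemma multiplication_class f : f \in Lphi -> (fun x => u x * f x) \in Lphi.
Proof.
move=> fL; have [g gE _] := M_mul (insubd 0 f).
rewrite (_ : (fun _ => _) = g); first exact: orlicz_funP.
by apply/funext => x; rewrite gE val_insubd_class.
Qed.

Lemma multiplication_cls f : f \in Lphi -> M (cls f) = cls (fun x => u x * f x).
Proof.
move=> fL; have [g gE ME] := M_mul (insubd 0 f).
rewrite (_ : (fun _ => _) = g); first by rewrite cls_pi.
by apply/funext => x; rewrite gE val_insubd_class.
Qed.

End multiplication.

(** * Finite dimension of a supported subspace against finite unions of atoms *)

Hypothesis omega_int : mu.-integrable setT (EFin \o omega).

Let indicL B : measurable B -> (fun x => (\1_B x)%:C) \in Lphi.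
Proof. exact: indic_orlicz_class. Qed.

(** Otherwise [n + 1] indicators of disjoint non-null sets lie in the span of [n] vectors. A
    nontrivial relation between them, read on a [B i] with nonzero coefficient, makes that [B i]
    null. *)
Lemma finite_dimensional_ae_simple A : measurable A ->
  finite_dimensional (orlicz_supported mu phiO omega_ge0 A) ->
  ae_simple mu omega A.
Proof.
move=> mA [n [b [_ bA]]]; apply: contrapT => /(not_ae_simple_sequence mA).
move=> [B [BA Bdis]].
pose e (i : 'I_n.+1) : T -> R[i] := fun x => (\1_(B i) x)%:C.
have eL i : e i \in Lphi by apply: indicL; have [] := BA i.
have /choice[c cE] i : exists c, cls (e i) = \sum_j c j *: b j.
  apply: bA; apply/orlicz_supportedP; exists (e i); split => // t nAt.
  by rewrite /e indicE memNset// => Bt; apply: nAt; have [_ + _] := BA i; exact.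
pose C := \matrix_(i, j) c i j.
(* The matrix [C] has [n + 1] rows and only [n] columns, so its left kernel is nonzero. *)
have [v /sub_kermxP vC v0] : exists2 v : 'rV_n.+1, (v <= kermx C)%MS & v != 0.
  apply/rowV0Pn; rewrite -mxrank_eq0 mxrank_ker subn_eq0 -ltnNge ltnS.
  exact: rank_leq_col.
have [i vi] : exists i, v 0 i != 0.
  apply: contrapT => /forallNP v00; move/eqP: v0; apply.
  by apply/rowP => i; rewrite mxE; apply/eqP; apply: contrapT => /negP/v00.
have [sL sE] := @cls_sum n.+1 (fun i => v 0 i) e eL.
have : cls (\sum_i v 0 i *: e i) = cls 0.
  rewrite sE cls0; under eq_bigr do rewrite cE scaler_sumr.
  rewrite exchange_big/= big1// => j _.
  under eq_bigr do rewrite scalerA; rewrite -scaler_suml.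
  have := congr1 (fun M : 'rV_n => M 0 j) vC; rewrite !mxE => vC0.
  rewrite (_ : \sum_i _ = 0) ?scale0r// -[RHS]vC0.
  by apply: eq_bigr => k _; rewrite mxE.
move/(cls_eqP sL orlicz_class0).
have [_ _ nB] := BA i; apply: contra_not nB; rewrite /weighted_negligible.
apply: filterS => x + Bx; rewrite fct_sumE (bigD1 i)//= big1 => [|j ji].
  rewrite addr0 -[LHS]/(v 0 i * e i x) /e indicE mem_set// mulr1 => vi0.
  by case/eqP: vi.
have nBj : ~ B j x.
  move=> Bjx; move: ji; rewrite neq_ltn => /orP[] h.
    by rewrite -[False]/(set0 x) -(Bdis _ _ h).
  by rewrite -[False]/(set0 x) -(Bdis _ _ h).
by rewrite -[LHS]/(v 0 j * e j x) /e indicE memNset// mulr0.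
Qed.

(** The indicators of the pieces span: the coefficients of [f] are its a.e. constant values on
    them. *)
Lemma ae_simple_finite_dimensional A : measurable A -> ae_simple mu omega A ->
  finite_dimensional (orlicz_supported mu phiO omega_ge0 A).
Proof.
move=> mA [m [i [im ci]]].
pose E k := A `&` [set x | i x = k].
pose e (k : 'I_m) : T -> R[i] := fun x => (\1_(E k) x)%:C.
have eL k : e k \in Lphi by apply: indicL; have [] := ci k.
exists m, (fun k => cls (e k)); split.
  move=> k; apply/orlicz_supportedP; exists (e k); split => // t nAt.
  by rewrite /e indicE memNset// => -[].
move=> x /orlicz_supportedP[f [fL fA ->]].
have /choice[c cE] (k : 'I_m) : exists c, \forall x \near weighted_ae mu omega, E k x -> f x = c.
  have [_] := ci k; apply; exact: orlicz_class_measurable fL.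
exists c; have [sL <-] := @cls_sum m c e eL.
apply/cls_eqP => //; have := @filter_forall _ _ _ _ (weighted_ae_filter mu omega) cE.
apply: filterS => t cEt; rewrite fct_sumE.
have [At|nAt] := pselect (A t); last first.
  rewrite fA// big1// => k _; rewrite -[LHS]/(c k * e k t) /e indicE memNset ?mulr0//.
  by case.
rewrite (bigD1 (Ordinal (im t)))//= big1 => [|k kt].
  rewrite addr0 -[RHS]/(c (Ordinal (im t)) * e (Ordinal (im t)) t).
  by rewrite /e indicE mem_set// mulr1; exact: cEt.
rewrite -[LHS]/(c k * e k t) /e indicE memNset ?mulr0// => -[_ /= itk].
by move: kt; rewrite -val_eqE/= itk eqxx.
Qed.

End orlicz_classes.

(** * Compactness of the operator forces finitely many atoms where [|u| >= eps] *)

Lemma ball_norm_lt (K : numDomainType) (V : pseudoMetricNormedZmodType K)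
  (p q : V) (e : K) : ball p e q -> `|p - q| < e.
Proof. by rewrite -ball_normE. Qed.

Lemma compact_multiplication_ae_simple d (T : measurableType d) (R : realType)
    (mu : {measure set T -> \bar R}) (phi : R -> R) (phiO : orlicz_function phi)
    (omega : {mfun T >-> R}) (omega_ge0 : forall x, 0 <= omega x)
    (u : T -> R[i])
    (M : orlicz_space mu phiO omega_ge0 -> orlicz_space mu phiO omega_ge0)
    (eps : R) :
  mu.-integrable setT (EFin \o omega) -> is_multiplication u M ->
  compact_operator M -> 0 < eps ->
  measurable [set x | eps <= normc (u x)] ->
  ae_simple mu omega [set x | eps <= normc (u x)].
Proof.
move=> omega_int M_mul cM eps0 mA; apply: contrapT => /(not_ae_simple_sequence mA).
move=> [B [BA Bdis]].
have Bdis' m n x : m != n -> B m x -> ~ B n x.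
  rewrite neq_ltn => /orP[] h Bmx Bnx; rewrite -[False]/(set0 x) -(Bdis _ _ h)//.
pose e n : T -> R[i] := fun x => (\1_(B n) x)%:C.
have eL n : e n \in orlicz_class mu phi omega.
  by apply: indic_orlicz_class => //; have [] := BA n.
pose N n := luxemburg_norm mu phi omega (e n).
have N0 n : 0 < N n.
  rewrite lt_neqAle luxemburg_ge0 andbT eq_sym; apply/eqP.
  move=> /(luxemburg_null phiO omega_ge0 (eL n)) en0.
  have [_ _] := BA n; apply; apply: filterS en0 => x + wx Bx => /(_ wx) /eqP.
  by rewrite /e indicE mem_set// oner_eq0.
pose f n := ((N n)^-1)%:C *: e n.
have fL n : f n \in orlicz_class mu phi omega by exact: orlicz_classZ.
have f1 n : luxemburg_norm mu phi omega (f n) = 1.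
  rewrite luxemburgZ// normcR ger0_norm ?invr_ge0 ?(ltW (N0 n))// mulVf//.
  by rewrite gt_eqF.
pose y n := M (cls mu phiO omega_ge0 (f n)).
have yK n : closure (M @` [set x | `|x| <= 1]) (y n).
  by apply: subset_closure; exists (cls mu phiO omega_ge0 (f n)) => //=; rewrite norm_cls// f1.
have yF : (y @ \oo) (closure (M @` [set x | `|x| <= 1])).
  by exists 0%N => // n _; exact: yK.
(* Two terms of the sequence within [eps / 2] of a cluster point will contradict
   [eps]-separation. *)
have [p [_ clp]] := cM _ _ yF.
have pe : nbhs p (ball p (eps / 2)%:C).
  by apply: nbhsx_ballx; rewrite ltcR divr_gt0.
have [_ [[n _ <-] pn]] : (range y `&` ball p (eps / 2)%:C) !=set0.
  by apply: clp => //; exists 0%N => // n _; exists n.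
(* Choosing [m] beyond [n] makes the supports [B n] and [B m] disjoint. *)
have [_ [[m nm <-] pm]] : ((y @` [set m | (n < m)%N]) `&` ball p (eps / 2)%:C) !=set0.
  by apply: clp => //; exists n.+1 => // k /= nk; exists k.
have : `|y n - y m| < eps%:C.
  rewrite [eps]splitr rmorphD /=; apply: le_lt_trans (ler_distD p _ _) _.
  apply: ltrD; last exact: ball_norm_lt pm.
  rewrite distrC; exact: ball_norm_lt pn.
have ufL k := multiplication_class M_mul (fL k).
rewrite /y !(multiplication_cls M_mul)// -clsB// norm_cls ?orlicz_classB// ltcR.
apply/negP; rewrite -leNgt.
(* The difference dominates [eps * f n]: on [B n] it equals [u * f n] with [|u| >= eps], and
   elsewhere [f n] vanishes. *)
have : luxemburg_norm mu phi omega (eps%:C *: f n) = eps.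
  by rewrite luxemburgZ// f1 mulr1 normcR gtr0_norm.
move=> {1}<-; apply: proj2 (luxemburg_dominated phiO omega_ge0 _ _ _).
- exact: orlicz_class_measurable (orlicz_classZ phiO omega_ge0 _ (fL n)).
- exact: orlicz_classB.
move=> x; rewrite -[X in normc X <= _]/(eps%:C * f n x).
rewrite -[X in _ <= normc X]/(u x * f n x - u x * f m x).
have [Bx|Bx] := pselect (B n x).
  have -> : f m x = 0.
    rewrite -[LHS]/(_ * e m x) /e indicE memNset ?mulr0//.
    by apply: Bdis' Bx; rewrite ltn_eqF.
  rewrite mulr0 subr0; move: (f n x) => c.
  rewrite !normcM ler_wpM2r ?normc_ge0// normcR gtr0_norm//.
  by have [_ /(_ x Bx)] := BA n.
have -> : f n x = 0 by rewrite -[LHS]/(_ * e n x) /e indicE memNset ?mulr0.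
by rewrite mulr0 normc0 normc_ge0.
Qed.

(** * Compactness of multiplication by a function carried by countably many atoms *)

Lemma normc_Complex_le (R : realType) (a b : R) : normc (Complex a b) <= `|a| + `|b|.
Proof.
rewrite /= -[leRHS]ger0_norm ?addr_ge0// -sqrtr_sqr; apply: ler_wsqrtr.
rewrite -(real_normK (num_real a)) -(real_normK (num_real b)) sqrrD.
by rewrite lerD2r lerDl mulrn_wge0// mulr_ge0.
Qed.

Lemma normr_Re_le_normc (R : realType) (z : R[i]) : `|complex.Re z| <= normc z.
Proof. by case: z => a b /=; rewrite -sqrtr_sqr ler_wsqrtr// lerDl sqr_ge0. Qed.

Lemma normr_Im_le_normc (R : realType) (z : R[i]) : `|complex.Im z| <= normc z.
Proof. by case: z => a b /=; rewrite -sqrtr_sqr ler_wsqrtr// lerDr sqr_ge0. Qed.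

Section atomic_multiplication.
Context d (T : measurableType d) (R : realType).
Variables (mu : {measure set T -> \bar R}) (phi : R -> R).
Variable phiO : orlicz_function phi.
Variable omega : {mfun T >-> R}.
Variable omega_ge0 : forall x, 0 <= omega x.
Hypothesis omega_int : mu.-integrable setT (EFin \o omega).
Local Notation norm := (luxemburg_norm mu phi omega).
Local Notation Lphi := (orlicz_class mu phi omega).
Local Notation V := (orlicz_space mu phiO omega_ge0).
Local Notation cls := (cls mu phiO omega_ge0).

Variables (u : T -> R[i]) (M : V -> V).
Hypothesis M_mul : is_multiplication u M.

(** [cell] sends [x] to its level, bounding [|u x|], and to the index of its
    atom inside the level. *)
Variables (cell : T -> nat * nat) (width : nat -> nat).
Local Notation U := [set x | u x != 0].
Local Notation S := (fun j => U `&` [set x | cell x = j]).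
Hypothesis cell_atom : forall j, ae_constant mu omega (S j).
Hypothesis cell_width : forall x, u x != 0 -> ((cell x).2 < width (cell x).1)%N.
Hypothesis cell_level : forall x, u x != 0 -> (cell x).1%:R * normc (u x) <= 1.

Import ArrowAsProduct.
Local Notation Z := (prod_topology (fun _ : nat * nat * bool => (R : topologicalType))).
Implicit Types z w : Z.

(** The boolean index selects the real or the imaginary part, so that each coordinate is real and
    ranges over a segment. *)
Definition cellwise z (x : T) : R[i] :=
  if u x != 0 then Complex (z (cell x, true)) (z (cell x, false)) else 0.

Lemma measurable_cells (P : set (nat * nat)) :
  measurable [set x | u x != 0 /\ P (cell x)].
Proof.
have -> : [set x | u x != 0 /\ P (cell x)] =
    \bigcup_j (if `[< P j >] then S j else set0).
  apply/seteqP; split=> [x [ux Px]|x [j _]].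
    by exists (cell x) => //; case: asboolP.
  by case: asboolP => // Pj [ux /= cj]; rewrite cj.
apply: countable_bigcupT_measurable => [|j]; first exact: countableP.
by case: ifP => _ //; have [] := cell_atom j.
Qed.

Lemma measurable_cellwise_real (h : nat * nat -> R) :
  measurable_fun setT (fun x => if u x != 0 then h (cell x) else 0).
Proof.
move=> _ Y mY; rewrite setTI.
(* The function is 0 where [u] vanishes, a region contained in the preimage exactly when [Y]
   contains 0; the complement is described in that case. *)
have [Y0|Y0] := pselect (Y 0).
  rewrite (_ : _ @^-1` _ = ~` [set x | u x != 0 /\ ~ Y (h (cell x))]).
    by apply: measurableC; exact: (measurable_cells [set j | ~ Y (h j)]).
  apply/seteqP; split=> x /=; case: ifP => // _.
  - by move=> ? [_].
  - by move=> _ [].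
  - by move=> H; apply: contrapT => ?; exact: H.
rewrite (_ : _ @^-1` _ = [set x | u x != 0 /\ Y (h (cell x))]).
  exact: (measurable_cells [set j | Y (h j)]).
by apply/seteqP; split=> x /=; case: ifP => _; by [move=> ?; split | move/Y0 | case].
Qed.

Lemma measurable_cellwise z : measurable_complex (cellwise z).
Proof.
split; [have := measurable_cellwise_real (fun j => z (j, true))|
        have := measurable_cellwise_real (fun j => z (j, false))];
  by congr (measurable_fun _ _); apply/funext => x; rewrite /cellwise; case: ifP.
Qed.

Definition levels_below N := [set x | u x != 0 /\ ((cell x).1 < N)%N].

(** By [cell_width] only finitely many coordinates matter below the level [N], so their joint
    closeness is a neighbourhood in the product topology. The factor 2 adds real and imaginary
    parts. *)
Lemma cellwise_near z N (e : R) : 0 < e ->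
  \forall w \near nbhs z, forall x, levels_below N x ->
    normc (cellwise z x - cellwise w x) <= e *+ 2.
Proof.
move=> e0.
have H : \forall w \near nbhs z, forall (n : 'I_N) (k : 'I_(width n)) (b : bool),
    `|z (n : nat, k : nat, b) - w (n : nat, k : nat, b)| < e.
  apply: filter_forall => n; apply: filter_forall => k; apply: filter_forall => b.
  have zi : nbhs z (proj (n : nat, k : nat, b) @^-1` ball (z (n : nat, k : nat, b)) e).
    apply: (@proj_continuous _ (fun _ : nat * nat * bool => (R : topologicalType))).
    exact: nbhsx_ballx.
  refine (filterS (F := nbhs z) _ zi) => w.
  exact: (@ball_norm_lt R R).
apply: filterS H => w zw x [ux xN]; rewrite /cellwise ux.
have := zw (Ordinal xN) (Ordinal (cell_width ux)); rewrite /= -surjective_pairing => zwx.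
apply: le_trans (normc_Complex_le _ _) _.
by rewrite mulr2n lerD// ltW// (zwx true, zwx false).
Qed.

(** A function of norm at most 1 with value [c] on the atom satisfies [|c| * norm 1_S <= 1]. On a
    null cell the norm is 0 and so is its inverse, which forces the coordinate to be 0. *)
Definition coordinate_bound j := (norm (fun x => (\1_(S j) x)%:C))^-1.

Definition coordinates_of_ball : set Z :=
  [set z : Z | forall i, `[- coordinate_bound i.1, coordinate_bound i.1]%classic (z i)] `&`
  [set z : Z | cellwise z \in Lphi /\ norm (cellwise z) <= 1].

(** The Fatou property reduces to functions truncated below a level [N]. There a limit point is
    uniformly close to a member of the ball, and a uniform error [e *+ 2] costs [e *+ 2] times the
    norm of the constant 1. *)
Lemma closed_cellwise_ball : closed [set z : Z | cellwise z \in Lphi /\ norm (cellwise z) <= 1].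
Proof.
move=> z clz; apply: (luxemburg_fatou phiO omega_ge0 (W := levels_below)).
- exact: measurable_cellwise.
- by move=> N; exact: (measurable_cells [set j | (j.1 < N)%N]).
- by move=> m n mn x [ux xm]; split => //; exact: leq_trans mn.
- move=> x; rewrite /cellwise; case: ifP => [ux _|_]; last by rewrite eqxx.
  by exists (cell x).1.+1; split => //=.
move=> N.
have mN : measurable_complex (fun x => (\1_(levels_below N) x)%:C * cellwise z x).
  apply: measurable_complex_indic; last exact: measurable_cellwise.
  exact: (measurable_cells [set j | (j.1 < N)%N]).
have oneL (e : R) : (fun=> e%:C) \in Lphi.
  by apply: (bounded_orlicz_class phiO omega_ge0 omega_int (C := normc e%:C)) => //;
    exact: measurable_complex_cst.
have key (e : R) : 0 < e ->
    (fun x => (\1_(levels_below N) x)%:C * cellwise z x) \in Lphi /\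
    norm (fun x => (\1_(levels_below N) x)%:C * cellwise z x) <=
      1 + e *+ 2 * norm (fun=> 1%:C).
  move=> e0; have [w [[wL w1] zw]] := clz _ (cellwise_near z N e0).
  have [|H1 H2] := luxemburg_dominatedD phiO omega_ge0 mN wL (oneL (e *+ 2)).
    move=> x; rewrite normcM normc_indic normcR ger0_norm ?mulrn_wge0 ?(ltW e0)//.
    rewrite indicE; case: (boolP (x \in _)) => [/set_mem/zw xw|_].
      rewrite mul1r -[cellwise z x](subrK (cellwise w x)) addrC.
      by apply: le_trans (normcD _ _) _; rewrite lerD.
    by rewrite mul0r addr_ge0 ?normc_ge0// mulrn_wge0// ltW.
  split=> //; apply: le_trans H2 _; rewrite lerD//.
  rewrite (_ : (fun=> _) = (e *+ 2)%:C *: (fun _ : T => 1%:C)).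
    by rewrite luxemburgZ// normcR ger0_norm// mulrn_wge0// ltW.
  by apply/funext => x; rewrite -[RHS]/((e *+ 2)%:C * 1%:C) mulr1.
split; first by have [] := key 1 ltr01.
apply/ler_addgt0Pr => e e0; set c := norm (fun=> 1%:C) in key.
have c0 : 0 <= c by exact: luxemburg_ge0.
have c1 : 0 < c + 1 by rewrite ltr_wpDl.
(* The error becomes [e * (c / (c + 1)) <= e]; adding 1 covers [c = 0]. *)
have [|_] := key (e / 2 / (c + 1)); first by rewrite !divr_gt0.
move/le_trans; apply; rewrite lerD2l -[X in X * c]mulr_natl.
have -> : 2 * (e / 2 / (c + 1)) * c = e * (c / (c + 1)) by field; rewrite gt_eqF.
by rewrite ler_piMr ?(ltW e0)// ler_pdivrMr// mul1r lerDl.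
Qed.

Lemma compact_coordinates_of_ball : compact coordinates_of_ball.
Proof.
apply: compact_closedI; last exact: closed_cellwise_ball.
apply: (@tychonoff _ (fun _ : nat * nat * bool => (R : topologicalType))
  (fun i => `[- coordinate_bound i.1, coordinate_bound i.1]%classic)) => i.
exact: segment_compact.
Qed.

(** The coordinates are the values of [v] on the atoms. They recover [v] only where [u != 0], which
    is all that multiplication by [u] sees. *)
Lemma ball_coordinates (v : V) : `|v| <= 1 ->
  exists2 z, coordinates_of_ball z & M v = M (cls (cellwise z)).
Proof.
have [f fL ->] := cls_surj v; rewrite norm_cls// lecR => f1.
have mf := orlicz_class_measurable fL.
(* On a null cell any constant would do; 0 is the one that respects [coordinate_bound]. *)
have /choice[h hP] j : exists c, (weighted_negligible mu omega (S j) -> c = 0) /\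
    \forall x \near weighted_ae mu omega, S j x -> f x = c.
  have [Sj|Sj] := pselect (weighted_negligible mu omega (S j)).
    by exists 0; split => //; move: Sj; rewrite /weighted_negligible; apply: filterS => x nS /nS.
  by have [_ /(_ f mf)[c fc]] := cell_atom j; exists c.
pose z : Z := fun i => if i.2 then complex.Re (h i.1) else complex.Im (h i.1).
have zE x : u x != 0 -> cellwise z x = h (cell x).
  by move=> ux; rewrite /cellwise ux /z /=; case: (h _).
have fz : \forall x \near weighted_ae mu omega, u x != 0 -> f x = cellwise z x.
  have : \forall x \near weighted_ae mu omega, forall n k, S (n, k) x -> f x = h (n, k).
    apply: weighted_ae_foralln => n; apply: weighted_ae_foralln => k.
    by have [] := hP (n, k).
  apply: filterS => x + ux; rewrite zE// => /(_ (cell x).1 (cell x).2).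
  by rewrite -surjective_pairing; apply; split.
have mU : measurable U.
  have := measurable_cells setT; rewrite (_ : [set x | _ /\ _] = U)//.
  by apply/seteqP; split=> [y []|y]//=.
have mg := measurable_complex_indic mU mf.
have [|gL gf] := luxemburg_dominated phiO omega_ge0 mg fL.
  by move=> y; rewrite normcM normc_indic ler_piMl ?normc_ge0.
have [|zL zg] := luxemburg_ae_eq phiO omega_ge0 gL (measurable_cellwise z).
  apply: filterS fz => y fy; rewrite indicE.
  have [uy|uy] := eqVneq (u y) 0.
    by rewrite memNset ?mul0r /cellwise ?uy ?eqxx//= => /eqP.
  by rewrite mem_set// mul1r fy.
have z1 : norm (cellwise z) <= 1 by rewrite (le_trans zg)// (le_trans gf).
exists z; last first.
  rewrite !(multiplication_cls M_mul)//; apply/cls_eqP.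
  - exact: (multiplication_class M_mul).
  - exact: (multiplication_class M_mul).
  apply: filterS fz => y fy; have [->|/fy ->//] := eqVneq (u y) 0.
  by rewrite !mul0r.
split=> // -[j b] /=.
have SL : (fun y => (\1_(S j) y)%:C) \in Lphi.
  by apply: indic_orlicz_class => //; have [] := cell_atom j.
have hj : normc (h j) <= coordinate_bound j.
  have [Sj|Sj] := pselect (weighted_negligible mu omega (S j)).
    by rewrite (hP j).1// normc0 invr_ge0 luxemburg_ge0.
  have N0 : 0 < norm (fun y => (\1_(S j) y)%:C).
    rewrite lt_neqAle luxemburg_ge0// andbT eq_sym; apply/eqP.
    move=> /(luxemburg_null phiO omega_ge0 SL) SN; apply: Sj.
    apply: filterS SN => y + wy Sy => /(_ wy) /eqP.
    by rewrite indicE mem_set// oner_eq0.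
  rewrite -[coordinate_bound j]mul1r ler_pdivlMr// -luxemburgZ//.
  apply: le_trans z1; apply: proj2 (luxemburg_dominated phiO omega_ge0 _ zL _).
    exact: orlicz_class_measurable (orlicz_classZ phiO omega_ge0 _ SL).
  move=> y; rewrite -[X in normc X <= _]/(h j * (\1_(S j) y)%:C).
  rewrite normcM normc_indic indicE; case: (boolP (y \in _)) => [|_].
    by move/set_mem => [uy /= yj]; rewrite mulr1 zE// yj.
  by rewrite mulr0 normc_ge0.
rewrite in_itv /= -ler_norml; apply: le_trans hj; rewrite /z /=.
by case: b; [exact: normr_Re_le_normc|exact: normr_Im_le_normc].
Qed.

(** It is the image under multiplication of the constant 1, which belongs to the class as [omega] is
    integrable. *)
Lemma multiplier_class : u \in Lphi.
Proof.
have oneL : (fun=> 1) \in Lphi.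
  by apply: (bounded_orlicz_class phiO omega_ge0 omega_int (C := normc 1)).
rewrite (_ : u = (fun x => u x * 1)); first exact: (multiplication_class M_mul oneL).
by apply/funext => x; rewrite mulr1.
Qed.

(** Below the level [N] the difference of the images is at most [del *+ 2] times [|u|], whose norm
    is finite. From [N] on, [|u| <= 1 / N] while the two ball members differ by norm at most 2. Each
    contribution is held to [e / 2]. *)
Lemma multiplication_cellwise_continuous :
  {within coordinates_of_ball, continuous (fun z => M (cls (cellwise z)))}.
Proof.
apply/subspace_continuousP => z [_ [zL z1]].
apply/(@cvgrPdist_lt _ V) => e; rewrite ltcE /= => /andP[/eqP e_im e_re].
have -> : e = (complex.Re e)%:C by case: e e_im {e_re} => a b /= ->.
move: (complex.Re e) e_re => {e_im} {}e e0.
pose c := norm u; have c0 : 0 <= c by exact: luxemburg_ge0.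
have c1 : 0 < c + 1 by rewrite ltr_wpDl.
pose N := (Num.truncn (4 / e)).+1.
have NN : 2 / N%:R < e / 2.
  rewrite ltr_pdivrMr// mulrAC ltr_pdivlMr// -ltr_pdivrMl//.
  apply: le_lt_trans (truncnS_gt (4 / e)).
  by rewrite mulrC ler_pM2r ?invr_gt0// -natrM.
pose del := e / 4 / (c + 1).
have del0 : 0 < del by rewrite !divr_gt0.
have delc : del *+ 2 * c <= e / 2.
  rewrite -[X in X * c]mulr_natl.
  have -> : 2 * del * c = e / 2 * (c / (c + 1)) by rewrite /del; field; rewrite gt_eqF.
  by rewrite ler_piMr ?divr_ge0 ?(ltW e0)// ler_pdivrMr// mul1r lerDl.
have H := cellwise_near z N del0.
apply: filterS H => w zw [_ [wL w1]].
rewrite -[X in X < _]/(`|M (cls (cellwise z)) - M (cls (cellwise w))|).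
have uzL := multiplication_class M_mul zL.
have uwL := multiplication_class M_mul wL.
rewrite !(multiplication_cls M_mul)// -clsB// norm_cls ?orlicz_classB// ltcR.
have zwL := orlicz_classB phiO omega_ge0 zL wL.
have guL := orlicz_classZ phiO omega_ge0 (del *+ 2)%:C multiplier_class.
have ghL := orlicz_classZ phiO omega_ge0 (N%:R^-1)%:C zwL.
have [||_] := @luxemburg_dominatedD _ _ _ mu _ phiO _ omega_ge0
    ((fun x => u x * cellwise z x) - (fun x => u x * cellwise w x)) _ _ _ guL ghL.
- by apply: orlicz_class_measurable (orlicz_classB phiO omega_ge0 uzL uwL).
- move=> x; rewrite -[X in normc X <= _]/(u x * cellwise z x - u x * cellwise w x).
  rewrite -[X in _ <= normc X + _]/((del *+ 2)%:C * u x).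
  rewrite -[X in _ <= _ + normc X]/((N%:R^-1)%:C * (cellwise z x - cellwise w x)).
  rewrite -mulrBr; have [->|ux] := eqVneq (u x) 0.
    by rewrite mul0r normc0 addr_ge0 ?normc_ge0.
  rewrite !normcM !normcR !ger0_norm ?invr_ge0 ?mulrn_wge0 ?(ltW del0)//.
  have [xN|xN] := ltnP (cell x).1 N.
    apply: ler_wpDr; first by rewrite mulr_ge0 ?normc_ge0.
    by rewrite mulrC ler_wpM2r ?normc_ge0//; exact: zw.
  apply: ler_wpDl; first by rewrite mulr_ge0 ?normc_ge0// mulrn_wge0// ltW.
  rewrite ler_wpM2r ?normc_ge0// -[leRHS]mulr1 ler_pdivlMl//.
  by apply: le_trans (cell_level ux); rewrite ler_wpM2r ?normc_ge0// ler_nat.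
move=> /le_lt_trans; apply; rewrite !luxemburgZ//.
  rewrite !normcR !ger0_norm ?invr_ge0 ?mulrn_wge0 ?(ltW del0)//.
  rewrite [e]splitr; apply: ler_ltD => //; apply: le_lt_trans NN.
  rewrite mulrC ler_wpM2r// -scaleN1r.
  apply: le_trans (luxemburgD phiO omega_ge0 zL (orlicz_classZ phiO omega_ge0 _ wL)) _.
  by rewrite luxemburgZ// normcN normc1 mul1r -[2]/(1 + 1) lerD.
exact: multiplier_class.
Qed.

(** The image of the unit ball is a continuous image of the compact coordinate set, hence already
    closed. *)
Lemma atomic_multiplication_compact : compact_operator M.
Proof.
rewrite /compact_operator (_ : M @` _ = (fun z => M (cls (cellwise z))) @` coordinates_of_ball).
  have cK := continuous_compact multiplication_cellwise_continuous compact_coordinates_of_ball.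
  have clK := compact_closed (@norm_hausdorff _ V) cK.
  by move/closure_id: clK => <-.
apply/seteqP; split=> [_ [v /= v1 <-]|_ [z [_ [zL z1]] <-]].
  by have [z zK ->] := ball_coordinates v1; exists z.
by exists (cls (cellwise z)) => //=; rewrite norm_cls// lecR.
Qed.

End atomic_multiplication.

(** * Cells built from the levels of [|u|], and the equivalence *)

Lemma ae_constantS d (T : measurableType d) (R : realType)
    (mu : {measure set T -> \bar R}) (omega : {mfun T >-> R}) (E F : set T) :
  F `<=` E -> measurable F -> ae_constant mu omega E -> ae_constant mu omega F.
Proof.
move=> FE mF [_ cE]; split=> // f mf; have [c fc] := cE f mf.
by exists c; apply: filterS fc => x fx /FE.
Qed.

Lemma measurable_ge_cst d (T : measurableType d) (R : realType) (g : T -> R) c :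
  measurable_fun setT g -> measurable [set x | c <= g x].
Proof.
move=> mg; rewrite (_ : [set _ | _] = setT `&` g @^-1` `[c, +oo[); first exact: mg.
by apply/seteqP; split => x /=; rewrite in_itv/= andbT => // -[].
Qed.

Lemma ae_simple_levels_compact d (T : measurableType d) (R : realType)
    (mu : {measure set T -> \bar R}) (phi : R -> R) (phiO : orlicz_function phi)
    (omega : {mfun T >-> R}) (omega_ge0 : forall x, 0 <= omega x)
    (u : T -> R[i])
    (M : orlicz_space mu phiO omega_ge0 -> orlicz_space mu phiO omega_ge0) :
  mu.-integrable setT (EFin \o omega) ->
  measurable_complex u -> is_multiplication u M ->
  (forall n, ae_simple mu omega [set x | n.+1%:R^-1 <= normc (u x)]) ->
  compact_operator M.
Proof.
move=> omega_int mu_ M_mul /choice[m /choice[i mi]].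
have mnu := measurable_normc mu_.
(* The level is the integer part of [1 / |u x|]; level [n] lies in the set where
   [|u| >= 1 / (n + 1)] and is cut by the labelling [i n] of that set. *)
pose lev x := Num.truncn (normc (u x))^-1.
have normu x : u x != 0 -> 0 < normc (u x).
  by move=> ux; rewrite lt_neqAle normc_ge0 andbT eq_sym; apply: contra_neq ux => /eq0_normc.
have levP x : u x != 0 -> (lev x)%:R * normc (u x) <= 1 < (lev x).+1%:R * normc (u x).
  move=> ux; rewrite -ler_pdivlMr ?normu// -ltr_pdivrMr ?normu// !mul1r.
  by apply: Num.Theory.truncn_itv; rewrite invr_ge0 normc_ge0.
have levE n x : n%:R * normc (u x) <= 1 < n.+1%:R * normc (u x) -> u x != 0 /\ lev x = n.
  move=> nx; have ux : u x != 0.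
    by apply: contraTneq nx => ->; rewrite normc0 !mulr0 ltr10 andbF.
  split=> //; apply: Num.Theory.truncn_def.
  by rewrite -[(normc _)^-1]mul1r ler_pdivlMr ?ltr_pdivrMr ?normu.
apply: (@atomic_multiplication_compact _ _ _ mu _ phiO _ omega_ge0 omega_int u M M_mul
  (fun x => (lev x, i (lev x) x)) m) => [[n k]|x ux|x ux] /=.
- have cnk := (mi n).2 k; have [mnk _] := cnk.
  (* Level [n] is given by [n * |u| <= 1 < (n + 1) * |u|]. The signs are reversed to suit
     [measurable_ge_cst]. *)
  have -> : [set x | u x != 0] `&` [set x | (lev x, i (lev x) x) = (n, k)] =
      ([set x | n.+1%:R^-1 <= normc (u x)] `&` [set x | i n x = k]) `&`
      ([set x | -1 <= - (n%:R * normc (u x))] `\` [set x | -1 <= - (n.+1%:R * normc (u x))]).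
    apply/seteqP; split=> [x [ux [<- <-]]|x [[_ <-]] []] /=; last first.
      rewrite !lerN2 => nx /negP; rewrite -ltNge => xn.
      by have [ux <-] := levE n x (introT andP (conj nx xn)).
    have /andP[le1 lt1] := levP x ux; split; first split => //.
      by rewrite -div1r ler_pdivrMr// mulrC ltW.
    by rewrite !lerN2; split=> //; apply/negP; rewrite -ltNge.
  have mneg (c : R) : measurable_fun setT (fun x => - (c * normc (u x))).
    by apply: measurableT_comp => //; exact: measurable_funM.
  apply: ae_constantS cnk; first exact: subIsetl.
  apply: measurableI => //.
  by apply: measurableD; apply: measurable_ge_cst; exact: mneg.
- exact: (mi _).1.
- by have /andP[] := levP x ux.
Qed.

Theorem theorem3p8 (R : realType) (d : measure_display) (T : measurableType d)
    (mu : {sigma_finite_measure set T -> \bar R})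
    (mu_complete : measure_is_complete mu)
    (tau : T -> T) (tau_measurable : measurable_fun setT tau)
    (tau_nonsingular : nonsingular mu tau)
    (omega : {mfun T >-> R}) (omega_ge0 : forall x, 0 <= omega x)
    (omega_RN : is_RN_weight mu tau omega)
    (phi : R -> R) (phiO : orlicz_function phi)
    (mu_finite : (mu [set: T] < +oo)%E)
    (u : T -> R[i]) (u_measurable : measurable_complex u)
    (Mu : orlicz_space mu phiO omega_ge0 -> orlicz_space mu phiO omega_ge0)
    (Mu_mul : is_multiplication u Mu) (Mu_bounded : bounded_operator Mu) :
  compact_operator Mu <->
  forall eps : R, 0 < eps ->
    finite_dimensional (orlicz_supported mu phiO omega_ge0
      [set x | eps <= Normc.normc (u x)]).
Proof.
(* As [mu] is finite, local integrability of the weight on the whole space is integrability. *)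
have omega_int := RN_weight_locally_integrable omega_RN measurableT mu_finite.
have mA (eps : R) : measurable [set x | eps <= normc (u x)].
  exact: (measurable_ge_cst eps (measurable_normc u_measurable)).
split=> [cM eps eps0|fdA].
  apply: ae_simple_finite_dimensional => //.
  exact: compact_multiplication_ae_simple Mu_mul cM eps0 _.
apply: (ae_simple_levels_compact omega_int u_measurable Mu_mul) => n.
have n0 : 0 < n.+1%:R^-1 :> R by rewrite invr_gt0.
exact: (finite_dimensional_ae_simple omega_int (mA _) (fdA _ n0)).
Qed.
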